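(* Assume: (a) $c\ge 1$ and $\alpha\ge1$ are fixed constants, and $(n,p,k)\to\infty$ with $p/n^{\alpha}\to c$; (b) the signal strength $\beta>0$, either fixed or growing with $n,p$, satisfies $\beta\le\sqrt{p/n}$; (c) the sparsity level $k$ satisfies $k\ge 2p/\sqrt n$, and $k/p\to0$. Assume further that $p\ge150^4\,n$. Let $X$ be a solution of the semidefinite program $$\operatorname{argmax}\{\langle\hat\Sigma,X\rangle : X\in\mathcal S^p_+,\ \operatorname{tr}(X)=1,\ \|X\|_S\le k\}.$$ Then, with probability tending to one as $(n,p,k)\to\infty$, $$\|X-\mathbf z\mathbf z^T\|\ge\tfrac13,$$ where $\|\cdot\|$ denotes the spectral norm.
   Context: Single-spike model: the spike $\mathbf z\in\mathbb R^p$ is a deterministic unit-length vector with exactly $k$ nonzero entries, each equal to $+1/\sqrt k$ or $-1/\sqrt k$. The samples are $\mathbf x_i=\sqrt{\beta}\,u_i\,\mathbf z+\boldsymbol\xi_i$ for $i=1,\dots,n$, where $\beta>0$ is the signal strength, $u_i\sim N(0,1)$, the vectors $\boldsymbol\xi_i\in\mathbb R^p$ have i.i.d. $N(0,1)$ entries, and all the $u_i$'s and $\boldsymbol\xi_i$'s are mutually independent. The sample covariance matrix is $\hat\Sigma=\frac1n\sum_{i=1}^n\mathbf x_i\mathbf x_i^T$. For $p\times p$ real matrices, $\langle A,B\rangle=\sum_{i,j}A_{ij}B_{ij}=\operatorname{tr}(A^TB)$, $\|X\|_S=\sum_{i,j}|X_{ij}|$, $\|A\|=\sqrt{\lambda_{\max}(AA^T)}$,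 and $\mathcal S^p_+$ is the cone of symmetric positive semidefinite $p\times p$ matrices. The parameter $k$ in the semidefinite program equals the sparsity of the spike. Asymptotic statements refer to sequences $p=p(n)$, $k=k(n)$ with $n\to\infty$, $p\to\infty$, $k\to\infty$. *)

(* Defs.v *)
From HB Require Import structures.
From mathcomp Require Import all_boot all_order all_algebra.
From mathcomp Require Import all_classical all_reals all_analysis.

Set Implicit Arguments.
Unset Strict Implicit.
Unset Printing Implicit Defensive.

Import Order.TTheory GRing.Theory Num.Theory.
Import numFieldNormedType.Exports.

Local Open Scope classical_set_scope.
Local Open Scope ring_scope.

Section matrices.
Context {R : realType} {p : nat}.
Implicit Types A B X : 'M[R]_p.

Definition mxdot A B : R := \sum_(i < p) \sum_(j < p) A i j * B i j.

Definition mxnormS X : R := \sum_(i < p) \sum_(j < p) `|X i j|.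

(* The set of eigenvalues is finite and, when p > 0 and A is symmetric,
   nonempty, so this supremum is then attained. *)
Definition lambda_max A : R := sup [set l : R | eigenvalue A l].

Definition spectral_norm A : R := Num.sqrt (lambda_max (A *m A^T)).

Definition psd A : Prop :=
  A^T = A /\ forall v : 'cV[R]_p, 0 <= (v^T *m A *m v) 0 0.

Definition sdp_feasible (k : nat) X : Prop :=
  [/\ psd X, \tr X = 1 & mxnormS X <= k%:R].

Definition sdp_solution (S : 'M[R]_p) (k : nat) X : Prop :=
  sdp_feasible k X /\
  forall Y : 'M[R]_p, sdp_feasible k Y -> mxdot S Y <= mxdot S X.

Definition sparse_spike (k : nat) (z : 'cV[R]_p) : Prop :=
  [/\ \sum_(i < p) z i 0 ^+ 2 = 1,
      #|[set i : 'I_p | z i 0 != 0]%SET| = k &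
      forall i : 'I_p, z i 0 != 0 ->
        z i 0 = (Num.sqrt k%:R)^-1 \/ z i 0 = - (Num.sqrt k%:R)^-1].

End matrices.

Section probability.
Context {R : realType} {d : measure_display} {T : measurableType d}.
Variable P : probability T R.

Definition standard_normal (X : {RV P >-> R}) : Prop :=
  forall A : set R, measurable A -> distribution P X A = normal_prob 0 1 A.

Definition mutually_independent (I : finType) (X : I -> {RV P >-> R}) : Prop :=
  forall (J : {set I}) (B : I -> set R),
    (forall i, measurable (B i)) ->
    P (\bigcap_(i in [set` J]) (X i @^-1` B i)) =
    (\prod_(i in J) P (X i @^-1` B i))%E.

Variables n p : nat.

Definition joint_family (u : 'I_n -> {RV P >-> R})
    (xi : 'I_n -> 'I_p -> {RV P >-> R}) (s : 'I_n + 'I_n * 'I_p) :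
    {RV P >-> R} :=
  match s with
  | inl i => u i
  | inr ij => xi ij.1 ij.2
  end.

Definition gaussian_model (u : 'I_n -> {RV P >-> R})
    (xi : 'I_n -> 'I_p -> {RV P >-> R}) : Prop :=
  (forall s, standard_normal (joint_family u xi s)) /\
  mutually_independent (joint_family u xi).

Definition sample (beta : R) (z : 'cV[R]_p) (u : 'I_n -> {RV P >-> R})
    (xi : 'I_n -> 'I_p -> {RV P >-> R}) (i : 'I_n) (w : T) : 'cV[R]_p :=
  (Num.sqrt beta * u i w) *: z + \col_(j < p) xi i j w.

Definition sample_cov (beta : R) (z : 'cV[R]_p) (u : 'I_n -> {RV P >-> R})
    (xi : 'I_n -> 'I_p -> {RV P >-> R}) (w : T) : 'M[R]_p :=
  n%:R^-1 *: \sum_(i < n)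
    (sample beta z u xi i w *m (sample beta z u xi i w)^T).

End probability.

(* "With probability tending to one", for sets that need not be measurable
   (the maximizer is an arbitrary selection): their inner probability tends
   to one.  For measurable E n this is P n (E n) --> 1. *)
Definition with_prob_tending_to_one {R : realType}
    {d : nat -> measure_display} {T : forall n, measurableType (d n)}
    (P : forall n, probability (T n) R) (E : forall n, set (T n)) : Prop :=
  exists A : forall n, set (T n),
    [/\ forall n, measurable (A n),
        forall n, A n `<=` E n &
        P n (A n) @[n --> \oo] --> 1%E].

(* Main.v *)
Require Import Defs.
From HB Require Import structures.
From mathcomp Require Import all_boot all_order all_algebra.
From mathcomp Require Import all_classical all_reals all_analysis.
From mathcomp Require Import measurable_realfun ring lra.

Set Implicit Arguments.
Unset Strict Implicit.
Unset Printing Implicit Defensive.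

Import Order.TTheory GRing.Theory Num.Theory.
Import numFieldNormedType.Exports.

Local Open Scope classical_set_scope.
Local Open Scope ring_scope.

(* Let N be the n x p noise matrix.  The matrix N^T N / tr (N^T N) is feasible
   for the program: Cauchy-Schwarz bounds its entrywise norm by
   p * sqrt (|N|^2 / tr (N^T N)), which is at most 2 p / sqrt n <= k.  Its
   objective value is about p / n.  If |X - z z^T| < 1/3, then z^T X z > 2/3, so
   X has trace less than 1/3 orthogonally to z; as the spike direction carries
   only O(1 + beta) = O(sqrt (p / n)), the objective at X is at most about
   |N|^2 / (3 n).  Since |N|^2 is at most about 2.22 p, X is not optimal.

   The bound on |N| is a union bound over a grid in the unit ball of R^n, whose
   cardinality exp (O(n)) is beaten by the chi-square tail exp (- c p) because
   p >= 150^4 n. *)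

(** * Quadratic forms and semidefinite matrices *)

Section forms.
Context {R : realType}.

(** Origin of the constants, in units of [p / n]: the weight below 1/3 left orthogonally to [z]
    earns less than 1.1 * 2.217 / 3 < 0.813, while the candidate earns 0.85 up to lower-order terms.
    The mesh 1/20 inflates the chi-square threshold [2 p] to [2 p / (19/20)^2 < 2.217 p], and 1.1 is
    the price of splitting the cross terms between [z] and its complement. The spike and these cross
    terms must fit in the remaining gap of 0.037; they do, since
    [beta * n <= sqrt (p * n) <= p / 150^2]. The upper bound is Lagrangian duality: the Gram matrix
    of the data is dominated by a combination of [z z^T] and [1 - z z^T], which is then paired with
    [X]. The noise is measured through its transpose because that acts on the space of small
    dimension [n], where a grid is affordable. Independence is given only as a product formula for
    events, so the Gaussian estimates are all derived from exponential moments, evaluated one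
    variable at a time. *)

Definition bil {m} (A : 'M[R]_m) (u v : 'cV[R]_m) : R := (u^T *m A *m v) 0 0.

Definition sqn {m} (v : 'cV[R]_m) : R := \sum_i v i 0 ^+ 2.

Lemma sqnE m (v : 'cV[R]_m) : sqn v = (v^T *m v) 0 0.
Proof. by rewrite mxE; apply: eq_bigr => i _; rewrite mxE expr2. Qed.

Lemma sqn_ge0 m (v : 'cV[R]_m) : 0 <= sqn v.
Proof. by apply: sumr_ge0 => i _; exact: sqr_ge0. Qed.

Lemma sqn_eq0 m (v : 'cV[R]_m) : sqn v = 0 -> v = 0.
Proof.
move=> v0; apply/colP => i; rewrite mxE; apply/eqP; rewrite -sqrf_eq0.
by apply/eqP; move: i (erefl true); apply: psumr_eq0P => // i _; exact: sqr_ge0.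
Qed.

Lemma sqnZ m a (v : 'cV[R]_m) : sqn (a *: v) = a ^+ 2 * sqn v.
Proof.
by rewrite /sqn mulr_sumr; apply: eq_bigr => i _; rewrite mxE exprMn.
Qed.

Lemma bil1 m (v : 'cV[R]_m) : bil 1%:M v v = sqn v.
Proof. by rewrite /bil mulmx1 sqnE. Qed.

Lemma bilDl m (A : 'M[R]_m) u v w : bil A (u + v) w = bil A u w + bil A v w.
Proof. by rewrite /bil linearD !mulmxDl mxE. Qed.

Lemma bilDr m (A : 'M[R]_m) u v w : bil A w (u + v) = bil A w u + bil A w v.
Proof. by rewrite /bil mulmxDr mxE. Qed.

Lemma bilZl m (A : 'M[R]_m) a v w : bil A (a *: v) w = a * bil A v w.
Proof. by rewrite /bil linearZ /= -!scalemxAl mxE. Qed.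

Lemma bilZr m (A : 'M[R]_m) a v w : bil A w (a *: v) = a * bil A w v.
Proof. by rewrite /bil -!scalemxAr mxE. Qed.

Lemma bilC m (A : 'M[R]_m) u v : A^T = A -> bil A u v = bil A v u.
Proof.
move=> sA; rewrite /bil -[LHS]trace_mx11 -[RHS]trace_mx11 -mxtrace_tr.
by rewrite !trmx_mul sA trmxK mulmxA.
Qed.

Lemma bil_gram m n (M : 'M[R]_(n, m)) v : bil (M^T *m M) v v = sqn (M *m v).
Proof. by rewrite /bil sqnE trmx_mul !mulmxA. Qed.

Lemma bil_delta m (A : 'M[R]_m) i j :
  bil A (delta_mx i 0) (delta_mx j 0) = A i j.
Proof. by rewrite /bil trmx_delta -rowE -colE !mxE. Qed.

Lemma psd_cauchy m (A : 'M[R]_m) u v : psd A ->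
  bil A u v ^+ 2 <= bil A u u * bil A v v.
Proof.
move=> [sA pA].
have q0 (t : R) : 0 <= bil A u u + 2 * t * bil A u v + t ^+ 2 * bil A v v.
  have := pA (u + t *: v); rewrite -/(bil _ _ _).
  rewrite bilDl !bilDr !bilZl !bilZr (bilC v u sA) => h; apply: le_trans h _.
  by rewrite le_eqVlt; apply/orP; left; apply/eqP; ring.
have [v0|v0] := eqVneq (bil A v v) 0.
  have [->|b0] := eqVneq (bil A u v) 0; first by rewrite v0 mulr0 expr0n.
  (* The polynomial in [t] is affine here, and this [t] would give it the value -1. *)
  have := q0 (- (bil A u u + 1) / (2 * bil A u v)); rewrite v0 mulr0 addr0.
  have -> : 2 * (- (bil A u u + 1) / (2 * bil A u v)) * bil A u v =
      - (bil A u u + 1).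
    by field.
  by lra.
have vp : 0 < bil A v v by rewrite lt0r v0 pA.
have := q0 (- bil A u v / bil A v v) => h.
rewrite -subr_ge0.
have -> : bil A u u * bil A v v - bil A u v ^+ 2 =
    (bil A u u + 2 * (- bil A u v / bil A v v) * bil A u v +
     (- bil A u v / bil A v v) ^+ 2 * bil A v v) * bil A v v by field.
by rewrite mulr_ge0 // ltW.
Qed.

Lemma psd1 m : psd (1%:M : 'M[R]_m).
Proof. by split; [exact: trmx1 | move=> v; rewrite -/(bil _ _ _) bil1 sqn_ge0]. Qed.

Lemma cauchy_schwarz m (u v : 'cV[R]_m) : (u^T *m v) 0 0 ^+ 2 <= sqn u * sqn v.
Proof. by have := psd_cauchy u v (psd1 m); rewrite !bil1 /bil mulmx1. Qed.

Lemma psd_diag_ge0 m (A : 'M[R]_m) i : psd A -> 0 <= A i i.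
Proof. by move=> [_ pA]; rewrite -bil_delta; exact: pA. Qed.

Lemma psd_diag0 m (A : 'M[R]_m) i j : psd A -> A i i = 0 -> A i j = 0.
Proof.
move=> pA Ai; apply/eqP; rewrite -sqrf_eq0 eq_le sqr_ge0 andbT.
by have := psd_cauchy (delta_mx i 0) (delta_mx j 0) pA; rewrite !bil_delta Ai mul0r.
Qed.

(** * The entrywise inner product and the semidefinite cone *)

Lemma mxdotDr m (A B C : 'M[R]_m) : mxdot A (B + C) = mxdot A B + mxdot A C.
Proof.
rewrite /mxdot -big_split; apply: eq_bigr => i _; rewrite -big_split.
by apply: eq_bigr => j _; rewrite mxE mulrDr.
Qed.

Lemma mxdotC m (A B : 'M[R]_m) : mxdot A B = mxdot B A.
Proof. by apply: eq_bigr => i _; apply: eq_bigr => j _; rewrite mulrC. Qed.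

Lemma mxdotZr m (A B : 'M[R]_m) a : mxdot A (a *: B) = a * mxdot A B.
Proof.
rewrite /mxdot mulr_sumr; apply: eq_bigr => i _; rewrite mulr_sumr.
by apply: eq_bigr => j _; rewrite mxE; ring.
Qed.

Lemma mxdotDl m (A B C : 'M[R]_m) : mxdot (B + C) A = mxdot B A + mxdot C A.
Proof. by rewrite mxdotC mxdotDr !(mxdotC A). Qed.

Lemma mxdotZl m (A B : 'M[R]_m) a : mxdot (a *: A) B = a * mxdot A B.
Proof. by rewrite mxdotC mxdotZr mxdotC. Qed.

Lemma mxdot_outer m (A : 'M[R]_m) v : mxdot A (v *m v^T) = bil A v v.
Proof.
rewrite /mxdot /bil !mxE exchange_big; apply: eq_bigr => j _.
rewrite mxE mulr_suml; apply: eq_bigr => i _.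
by rewrite !mxE big_ord1 !mxE; ring.
Qed.

Lemma mxdot1 m (A : 'M[R]_m) : mxdot 1%:M A = \tr A.
Proof.
apply: eq_bigr => i _; rewrite (bigD1 i) //= big1 ?addr0 ?mxE ?eqxx ?mul1r //.
by move=> j ji; rewrite mxE eq_sym (negbTE ji) mul0r.
Qed.

Lemma bilD m (A B : 'M[R]_m) u v : bil (A + B) u v = bil A u v + bil B u v.
Proof. by rewrite /bil mulmxDr mulmxDl mxE. Qed.

Lemma bilZ m (A : 'M[R]_m) a u v : bil (a *: A) u v = a * bil A u v.
Proof. by rewrite /bil -scalemxAr -scalemxAl mxE. Qed.

Lemma bilB m (A B : 'M[R]_m) u v : bil (A - B) u v = bil A u v - bil B u v.
Proof. by rewrite bilD -scaleN1r bilZ mulN1r. Qed.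

Lemma mxdotBl m (A B C : 'M[R]_m) : mxdot (B - C) A = mxdot B A - mxdot C A.
Proof. by rewrite mxdotDl -scaleN1r mxdotZl mulN1r. Qed.

Lemma bil_outer m (w v : 'cV[R]_m) :
  bil (w *m w^T) v v = (w^T *m v) 0 0 ^+ 2.
Proof.
rewrite /bil mulmxA -mulmxA mxE big_ord1 expr2; congr (_ * _).
by rewrite -trace_mx11 -mxtrace_tr trmx_mul trmxK trace_mx11.
Qed.

(** One step of Gaussian elimination. Positivity of the remainder at [v] is exactly Cauchy-Schwarz
    for the form [C] between the basis vector [j] and [v]. *)
Lemma psd_deflate m (C : 'M[R]_m) j : psd C -> 0 < C j j ->
  psd (C - (C j j)^-1 *: (col j C *m (col j C)^T)).
Proof.
move=> pC Cj; have [sC qC] := pC; split.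
  by rewrite linearB linearZ /= trmx_mul trmxK sC.
move=> v; rewrite -/(bil _ _ _) -scaleNr bilD bilZ bil_outer.
have -> : ((col j C)^T *m v) 0 0 = bil C (delta_mx j 0) v.
  by rewrite colE trmx_mul sC.
have := psd_cauchy (delta_mx j 0) v pC; rewrite bil_delta => h.
by rewrite mulNr subr_ge0 mulrC ler_pdivrMr // mulrC.
Qed.

(** Deflation replaces a spectral decomposition. Each step splits off a rank-one term, whose product
    with [A] is a value of the form [A]. It clears one diagonal entry of [C] and creates none,
    because diagonal entries only decrease and stay nonnegative; hence the induction on the number
    of nonzero diagonal entries. *)
Lemma mxdot_psd_ge0 m (A C : 'M[R]_m) : psd A -> psd C -> 0 <= mxdot A C.
Proof.
move=> pA.
move: {2}#|[set i | C i i != 0]%SET| (leqnn #|[set i | C i i != 0]%SET|) => N.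
elim: N C => [|N IH] C cC pC.
  have C0 i : C i i = 0.
    apply/eqP/negPn/negP => Ci; move: cC; rewrite leqn0 cards_eq0 => /eqP/setP/(_ i).
    by rewrite !inE Ci.
  rewrite /mxdot big1 // => i _; rewrite big1 // => j _.
  by rewrite (psd_diag0 _ pC) ?mulr0.
have [C0|] := boolP [forall i, C i i == 0].
  rewrite /mxdot big1 // => i _; rewrite big1 // => j _.
  by rewrite (psd_diag0 _ pC) ?mulr0 //; apply/eqP/(forallP C0).
rewrite negb_forall => /existsP[j Cj0].
have Cj : 0 < C j j by rewrite lt0r Cj0 psd_diag_ge0.
set D := C - (C j j)^-1 *: (col j C *m (col j C)^T).
have pD : psd D by exact: psd_deflate.
have DE i : D i i = C i i - (C j j)^-1 * C i j ^+ 2.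
  by rewrite !mxE big_ord1 !mxE expr2.
have -> : C = D + (C j j)^-1 *: (col j C *m (col j C)^T) by rewrite subrK.
rewrite mxdotDr mxdotZr mxdot_outer addr_ge0 //; last first.
  case: pA => _ qA; apply: mulr_ge0; last exact: qA.
  by rewrite invr_ge0 ltW.
apply: IH => //; rewrite -ltnS; apply: leq_trans cC; apply: proper_card.
apply/properP; split.
  apply/fintype.subsetP => i; rewrite !inE; apply: contra => /eqP Ci.
  have := psd_diag_ge0 i pD; rewrite DE Ci sub0r oppr_ge0 => h.
  by rewrite oppr_eq0 eq_le h mulr_ge0 ?sqr_ge0 // invr_ge0 ltW.
by exists j; rewrite !inE // negbK DE; apply/eqP; field.
Qed.

(** Crude, but any finite constant will do: it makes suprema over the unit sphere or ball finite and
    bounds the form of an inverse matrix. *)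
Lemma bil_bound m (B : 'M[R]_m) v : bil B v v <= mxnormS B * sqn v.
Proof.
have -> : bil B v v = mxdot B (v *m v^T) by rewrite mxdot_outer.
rewrite /mxdot /mxnormS mulr_suml; apply: ler_sum => i _.
rewrite mulr_suml; apply: ler_sum => j _.
apply: le_trans (ler_norm _) _; rewrite normrM ler_wpM2l //.
rewrite !mxE big_ord1 !mxE; apply: (@le_trans _ _ ((v i 0 ^+ 2 + v j 0 ^+ 2) / 2)).
  rewrite ler_norml; apply/andP; split.
    by have := sqr_ge0 (v i 0 + v j 0); lra.
  by have := sqr_ge0 (v i 0 - v j 0); lra.
have le k : v k 0 ^+ 2 <= sqn v.
  by rewrite /sqn (bigD1 k) //= lerDl sumr_ge0 // => l _; exact: sqr_ge0.
by have := le i; have := le j; lra.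
Qed.

Lemma le_sup_nonempty (E : set R) x M : E x -> ubound E M -> x <= sup E.
Proof. by move=> Ex EM; apply: ub_le_sup => //; exists M. Qed.

(* If the supremum [s] of the form over the unit sphere were not an eigenvalue,
   [s - A] would be invertible, hence bounded below by a positive multiple of
   the identity, which contradicts the choice of [s]. *)
Lemma bil_le_lambda_max m (A : 'M[R]_m) v : psd A -> sqn v = 1 ->
  bil A v v <= lambda_max A.
Proof.
move=> pA v1; pose E := [set bil A x x | x in [set x | sqn x = 1]].
have [sA _] := pA.
have Ev : E (bil A v v) by exists v.
have Eub : ubound E (mxnormS A).
  by move=> _ [x /= x1 <-]; rewrite -[leRHS]mulr1 -x1; exact: bil_bound.
set s := sup E.
have sE x : bil A x x <= s * sqn x.
  have [x0|x0] := eqVneq (sqn x) 0.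
    by rewrite (sqn_eq0 x0) /bil mulmx0 mxE /sqn big1 ?mulr0 // => i _; rewrite mxE expr0n.
  have xp : 0 < sqn x by rewrite lt0r x0 sqn_ge0.
  rewrite -ler_pdivrMr //; apply: (le_sup_nonempty _ Eub).
  have sx : Num.sqrt (sqn x) != 0 by rewrite gt_eqF // sqrtr_gt0.
  exists ((Num.sqrt (sqn x))^-1 *: x) => /=.
    by rewrite sqnZ exprVn sqr_sqrtr ?sqn_ge0 // mulVf.
  by rewrite bilZl bilZr mulrA -expr2 exprVn sqr_sqrtr ?sqn_ge0 // mulrC.
(* Boundedness of the set of eigenvalues matters: [sup] of an unbounded set is a default value and
   need not dominate [s]. *)
have evs l : eigenvalue A l -> l <= s.
  move=> /eigenvalueP[x xA x0].
  have xp : 0 < sqn x^T.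
    rewrite lt0r sqn_ge0 andbT; apply: contraNneq x0 => /sqn_eq0.
    by move=> /(congr1 trmx); rewrite trmxK trmx0 => ->.
  have := sE x^T; rewrite /bil trmxK xA -scalemxAl mxE.
  have -> : (x *m x^T) 0 0 = sqn x^T by rewrite sqnE trmxK.
  by rewrite ler_pM2r.
have evS : eigenvalue A s.
  case: (boolP (eigenvalue A s)) => // nev; exfalso.
  have Qu : s%:M - A \in unitmx.
    rewrite -row_free_unit -kermx_eq0; move: nev; rewrite /eigenvalue /eigenspace negbK.
    rewrite !kermx_eq0 !row_free_unit -opprB -scaleN1r.
    by rewrite unitmxZ // unitrN unitr1.
  set Q := s%:M - A in Qu.
  have QE x : bil Q x x = s * sqn x - bil A x x.
    by rewrite /Q -scaleN1r bilD bilZ mulN1r -scalemx1 bilZ bil1.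
  have pQ : psd Q.
    split; first by rewrite linearB /= sA tr_scalar_mx.
    by move=> x; rewrite -/(bil _ _ _) QE subr_ge0.
  pose M := mxnormS (invmx Q) + 1.
  have M0 : 0 < M by rewrite ltr_wpDl // sumr_ge0 // => i _; rewrite sumr_ge0.
  (* Cauchy-Schwarz for the form [Q] between [invmx Q *m x] and [x] gives
     [1 <= bil (invmx Q) x x * bil Q x x], and the first factor is at most [M]. *)
  have Qlow x : sqn x = 1 -> M^-1 <= bil Q x x.
    move=> x1; have := psd_cauchy (invmx Q *m x) x pQ.
    have Qsym : (invmx Q)^T = invmx Q by rewrite trmx_inv; case: pQ => ->.
    have -> : bil Q (invmx Q *m x) x = sqn x.
      by rewrite /bil trmx_mul Qsym mulmxKV // sqnE.
    have -> : bil Q (invmx Q *m x) (invmx Q *m x) = bil (invmx Q) x x.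
      by rewrite /bil trmx_mul Qsym mulmxKV // mulmxA.
    rewrite x1 expr1n => h.
    rewrite -[M^-1]mul1r ler_pdivrMr // mulrC; apply: le_trans h _.
    apply: ler_wpM2r; first by case: pQ => _ qQ; exact: qQ.
    by rewrite /M; have := bil_bound (invmx Q) x; rewrite x1; lra.
  have : s <= s - M^-1.
    apply: ge_sup; first by exists (bil A v v).
    move=> _ [x /= x1 <-]; have := Qlow x x1; rewrite QE x1 mulr1; lra.
  have : 0 < M^-1 by rewrite invr_gt0.
  lra.
have lub : ubound [set l | eigenvalue A l] s by move=> l /evs.
apply: le_trans (le_sup_nonempty evS lub).
exact: (le_sup_nonempty Ev Eub).
Qed.

(** By Cauchy-Schwarz the square of [v^T B v] is at most [|B v|^2], which is the form of [B B^T] at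
    [v]. *)
Lemma bil_le_spectral_norm m (B : 'M[R]_m) v : B^T = B -> sqn v = 1 ->
  `|bil B v v| <= spectral_norm B.
Proof.
move=> sB v1; rewrite /spectral_norm.
have pBB : psd (B *m B^T).
  split; first by rewrite trmx_mul trmxK.
  by move=> x; rewrite -/(bil _ _ _) sB -{1}sB bil_gram sqn_ge0.
rewrite -ler_sqr ?nnegrE ?sqrtr_ge0 // sqr_sqrtr; last first.
  by apply: le_trans (bil_le_lambda_max pBB v1); case: pBB => _ qB; exact: qB.
rewrite real_normK ?num_real //; apply: le_trans (bil_le_lambda_max pBB v1).
have := cauchy_schwarz v (B *m v); rewrite v1 mul1r -bil_gram sB.
by rewrite mulmxA.
Qed.
End forms.

(** * The semidefinite program on a good noise matrix *)

Section upper.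
Context {R : realType}.

(** The free weight [e] keeps the factor of the dominant noise part close to 1 and charges the cross
    term to the much smaller signal part. *)
Lemma sqnD_le m (u v : 'cV[R]_m) (e : R) : 0 < e ->
  sqn (u + v) <= (1 + e^-1) * sqn u + (1 + e) * sqn v.
Proof.
move=> e0; rewrite /sqn !mulr_sumr -big_split; apply: ler_sum => i _ /=.
rewrite !mxE -subr_ge0.
have -> : (1 + e^-1) * u i 0 ^+ 2 + (1 + e) * v i 0 ^+ 2 - (u i 0 + v i 0) ^+ 2
   = e^-1 * (u i 0 - e * v i 0) ^+ 2 by field; exact: lt0r_neq0.
by rewrite mulr_ge0 ?sqr_ge0 // invr_ge0 ltW.
Qed.

Variables (n p : nat) (Xi : 'M[R]_(n, p)) (U : 'cV[R]_n) (z : 'cV[R]_p).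
Variables (beta K : R).

Definition data := Num.sqrt beta *: (U *m z^T) + Xi.

Hypothesis z1 : sqn z = 1.
Hypothesis K0 : 0 <= K.
Hypothesis HK : forall v, sqn (Xi^T *m v) <= K * sqn v.

(** A matrix and its transpose have the same operator norm: [|Xi w|^4] is the squared inner product
    of [Xi^T Xi w] with [w], and one factor [|Xi w|^2] cancels. *)
Lemma noise_norm_le w : sqn (Xi *m w) <= K * sqn w.
Proof.
have [->|x0] := eqVneq (sqn (Xi *m w)) 0; first by rewrite mulr_ge0 ?sqn_ge0.
have xp : 0 < sqn (Xi *m w) by rewrite lt0r x0 sqn_ge0.
have := cauchy_schwarz (Xi^T *m (Xi *m w)) w.
rewrite trmx_mul trmxK -mulmxA -sqnE => h.
have := le_trans h (ler_wpM2r (sqn_ge0 w) (HK (Xi *m w))).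
by rewrite expr2 mulrAC ler_pM2r.
Qed.

Lemma data_mulz : data *m z = Num.sqrt beta *: U + Xi *m z.
Proof.
rewrite /data mulmxDl -scalemxAl -mulmxA; congr (_ *: _ + _).
by apply/colP => i; rewrite !mxE big_ord1 -sqnE z1 mulr1.
Qed.

Lemma signal_le : 0 <= beta ->
  sqn (data *m z) <= 2 * beta * sqn U + 2 * sqn (Xi *m z).
Proof.
move=> b0; rewrite data_mulz; apply: le_trans (sqnD_le _ _ ltr01) _.
by rewrite sqnZ sqr_sqrtr // invr1 mulrA.
Qed.

(** Split [v] into [t *: z] and a part orthogonal to [z]. On the latter the spike vanishes and
    [data] acts as pure noise. *)
Lemma gram_le v (t := (z^T *m v) 0 0) (e : R) : 0 < e ->
  sqn (data *m v) <= (1 + e^-1) * sqn (data *m z) * t ^+ 2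
     + (1 + e) * K * (sqn v - t ^+ 2).
Proof.
move=> e0; pose y := v - t *: z.
have zy : z^T *m y = 0.
  rewrite [LHS]mx11_scalar; have -> : (z^T *m y) 0 0 = 0.
    rewrite /y mulmxBr -scalemxAr [LHS]mxE [X in _ + X]mxE [X in - X]mxE -sqnE z1.
    by rewrite mulr1 subrr.
  by apply/matrixP => i j; rewrite !mxE mul0rn.
have vE : v = t *: z + y by rewrite addrC subrK.
clearbody y t.
have yE : sqn y = sqn v - t ^+ 2.
  rewrite vE -!bil1 bilDl !bilDr !bilZl !bilZr !bil1 z1.
  have -> : bil 1%:M z y = 0 by rewrite /bil mulmx1 zy mxE.
  have -> : bil 1%:M y z = 0 by rewrite bilC ?trmx1 // /bil mulmx1 zy mxE.
  by ring.
have dy : data *m y = Xi *m y.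
  by rewrite /data mulmxDl -scalemxAl -mulmxA zy mulmx0 scaler0 add0r.
rewrite {1}vE mulmxDr -scalemxAr; apply: le_trans (sqnD_le _ _ e0) _.
rewrite sqnZ dy -yE (mulrC (t ^+ 2)) mulrA lerD2l -mulrA ler_wpM2l //.
  by rewrite addr_ge0 // ltW.
exact: noise_norm_le.
Qed.

(** [gram_le] says that [a *: Z + b *: (1%:M - Z) - G] is semidefinite, a dual certificate to be
    paired with [X]. Pairing [X] with [1%:M - Z] gives [bil X z z <= 1], which removes that factor
    from the signal term. *)
Lemma upper_value (X : 'M[R]_p) (e : R) : 0 < e -> psd X -> \tr X = 1 ->
  mxdot (data^T *m data) X <=
    (1 + e^-1) * sqn (data *m z) + (1 + e) * K * (1 - bil X z z).
Proof.
move=> e0 pX tX; have GD v := gram_le v e0; move: GD.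
have GE v : bil (data^T *m data) v v = sqn (data *m v) by exact: bil_gram.
have sG : (data^T *m data)^T = data^T *m data by rewrite trmx_mul trmxK.
have ZE v : bil (z *m z^T) v v = (z^T *m v) 0 0 ^+ 2 by exact: bil_outer.
have ZX : mxdot (z *m z^T) X = bil X z z by rewrite mxdotC mxdot_outer.
have sZ : (z *m z^T)^T = z *m z^T by rewrite trmx_mul trmxK.
move: (z *m z^T) (data^T *m data) GE sG ZE ZX sZ => Z G GE sG ZE ZX sZ GD.
set a := (1 + e^-1) * _; set b := (1 + e) * K.
have pD : psd (a *: Z + b *: (1%:M - Z) - G).
  split; first by rewrite linearB linearD !linearZ /= linearB /= sG sZ trmx1.
  move=> v; rewrite -/(bil _ _ _) !(bilB, bilD, bilZ) bil1 ZE GE.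
  by have := GD v; rewrite -/a -/b; lra.
have pD1 : psd (1%:M - Z).
  split; first by rewrite linearB /= trmx1 sZ.
  move=> v; rewrite -/(bil _ _ _) bilB bil1 ZE.
  by have := cauchy_schwarz z v; rewrite z1; lra.
have := mxdot_psd_ge0 pD pX; have := mxdot_psd_ge0 pD1 pX.
rewrite !(mxdotBl, mxdotDl, mxdotZl) mxdot1 tX ZX => x1 h.
have a0 : 0 <= a.
  by rewrite mulr_ge0 ?sqn_ge0 // addr_ge0 // invr_ge0 ltW.
have := mulr_ge0 a0 x1; lra.
Qed.

(** * Feasibility and value of the normalized noise Gram matrix *)

Definition energy := \sum_(j < p) \sum_(i < n) Xi i j ^+ 2.

Lemma energyE : energy = \tr (Xi^T *m Xi).
Proof.
by apply: eq_bigr => j _; rewrite mxE; apply: eq_bigr => i _; rewrite mxE expr2.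
Qed.

Lemma sum_sqr_le m (a : 'I_m -> R) :
  (\sum_i a i) ^+ 2 <= m%:R * \sum_i a i ^+ 2.
Proof.
have := cauchy_schwarz (const_mx 1 : 'cV_m) (\col_i a i).
rewrite /sqn mxE; under eq_bigr do rewrite !mxE mul1r.
under [X in _ <= X * _ -> _]eq_bigr do rewrite mxE expr1n.
under [X in _ <= _ * X -> _]eq_bigr do rewrite mxE.
by rewrite sumr_const card_ord.
Qed.

(** Cauchy-Schwarz is applied across columns and then within each column. Column [j] of the Gram
    matrix is [Xi^T] applied to column [j] of [Xi], so [HK] bounds it, and the squared columns of
    [Xi] add up to [energy]. *)
Lemma mxnormS_gram : mxnormS (Xi^T *m Xi) ^+ 2 <= p%:R ^+ 2 * (K * energy).
Proof.
set W := Xi^T *m Xi; rewrite /mxnormS exchange_big /=.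
apply: le_trans (sum_sqr_le _) _; rewrite expr2 -mulrA ler_wpM2l // !mulr_sumr.
apply: ler_sum => j _; apply: le_trans (sum_sqr_le _) _; rewrite ler_wpM2l //.
have -> : \sum_i `|W i j| ^+ 2 = sqn (Xi^T *m col j Xi).
  apply: eq_bigr => i _; rewrite real_normK ?num_real // !mxE; congr (_ ^+ 2).
  by apply: eq_bigr => l _; rewrite !mxE.
apply: le_trans (HK _) _; rewrite ler_wpM2l //.
by rewrite le_eqVlt; apply/orP; left; apply/eqP; apply: eq_bigr => i _; rewrite mxE.
Qed.

Lemma mxdot_gram (A B : 'M[R]_(n, p)) :
  mxdot (A^T *m A) (B^T *m B) = \sum_i \sum_l (A *m B^T) i l ^+ 2.
Proof.
have sB : (B^T *m B)^T = B^T *m B by rewrite trmx_mul trmxK.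
transitivity (\tr ((A^T *m A) *m (B^T *m B))).
  apply: eq_bigr => i _; rewrite [RHS]mxE; apply: eq_bigr => j _.
  by rewrite -[in RHS]sB [_^T j i]mxE.
rewrite -mulmxA mxtrace_mulC !mulmxA.
transitivity (\tr ((A *m B^T) *m (A *m B^T)^T)).
  by rewrite trmx_mul trmxK !mulmxA.
apply: eq_bigr => i _; rewrite mxE; apply: eq_bigr => l _.
by rewrite [(_ *m _)^T l i]mxE expr2.
Qed.

Definition candidate : 'M[R]_p := energy^-1 *: (Xi^T *m Xi).

Lemma candidate_feasible k : 0 < energy -> n%:R * K <= 4 * energy ->
  2 * p%:R / Num.sqrt n%:R <= k%:R :> R -> (0 < n)%N ->
  sdp_feasible k candidate.
Proof.
move=> E0 nK hk n0; split.
- split; first by rewrite linearZ /= trmx_mul trmxK.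
  move=> v; rewrite -/(bil _ _ _) bilZ bil_gram mulr_ge0 ?sqn_ge0 //.
  by rewrite invr_ge0 ltW.
- by rewrite linearZ /= -energyE mulVf // gt_eqF.
- apply: le_trans hk.
  have -> : mxnormS candidate = energy^-1 * mxnormS (Xi^T *m Xi).
    rewrite /mxnormS mulr_sumr; apply: eq_bigr => i _; rewrite mulr_sumr.
    by apply: eq_bigr => j _; rewrite mxE normrM gtr0_norm // invr_gt0.
  have nr : 0 < n%:R :> R by rewrite ltr0n.
  rewrite -ler_sqr ?nnegrE; first last.
    by rewrite !mulr_ge0 // invr_ge0 sqrtr_ge0.
    by rewrite mulr_ge0 ?invr_ge0 ?(ltW E0) // sumr_ge0 // => i _; rewrite sumr_ge0.
  rewrite [leRHS]expr_div_n sqr_sqrtr // ler_pdivlMr // exprMn exprVn.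
  rewrite -mulrA mulrC ler_pdivrMr ?exprn_gt0 //.
  have h1 := ler_wpM2r (ltW nr) mxnormS_gram; apply: le_trans h1 _.
  have -> : p%:R ^+ 2 * (K * energy) * n%:R = (n%:R * K) * (p%:R ^+ 2 * energy) by ring.
  have -> : (2 * p%:R) ^+ 2 * energy ^+ 2 = 4 * energy * (p%:R ^+ 2 * energy) by ring.
  by rewrite ler_wpM2r // mulr_ge0 ?sqr_ge0 // ltW.
Qed.

(** The value is the squared Frobenius norm of [data *m Xi^T] over [energy]. Only its [n] diagonal
    entries are kept, and Cauchy-Schwarz bounds their squares below by the squared trace over [n].
    Little is lost, as [Xi Xi^T] is close to a multiple of the identity when [p] is much larger than
    [n]. The trace is [energy] plus the cross term [c]. *)
Lemma lower_value : 0 < energy -> (0 < n)%N ->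
  sqn U <= 2 * n%:R -> sqn (Xi *m z) <= 2 * n%:R ->
  energy / n%:R - 4 * Num.sqrt beta <= mxdot (data^T *m data) candidate.
Proof.
move=> E0 n0 hU hz.
have nr : 0 < n%:R :> R by rewrite ltr0n.
rewrite mxdotZr mxdot_gram [leRHS]mulrC ler_pdivlMr //.
pose c := Num.sqrt beta * (U^T *m (Xi *m z)) 0 0.
have hc : - (2 * n%:R * Num.sqrt beta) <= c.
  rewrite /c [X in - X]mulrC -mulrN ler_wpM2l ?sqrtr_ge0 //.
  have : `|(U^T *m (Xi *m z)) 0 0| <= 2 * n%:R.
    rewrite -ler_sqr ?nnegrE ?mulr_ge0 // real_normK ?num_real //.
    apply: le_trans (cauchy_schwarz _ _) _; rewrite expr2.
    by apply: ler_pM; rewrite ?sqn_ge0.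
  by rewrite ler_norml => /andP[h _]; lra.
have dE : \sum_i (data *m Xi^T) i i = energy + c.
  rewrite -[LHS]/(\tr _) /data mulmxDl linearD /= addrC energyE mxtrace_mulC.
  congr (_ + _); rewrite -scalemxAl linearZ /= /c; congr (_ * _).
  rewrite -mulmxA mxtrace_mulC -trace_mx11 -mxtrace_tr !trmx_mul !trmxK.
  by rewrite mulmxA.
apply: (@le_trans _ _ (\sum_i (data *m Xi^T) i i ^+ 2)); last first.
  apply: ler_sum => i _; rewrite (bigD1 i) //= lerDl sumr_ge0 // => l _.
  exact: sqr_ge0.
rewrite -(ler_pM2l nr); apply: le_trans (sum_sqr_le _); rewrite dE.
have -> : n%:R * ((energy / n%:R - 4 * Num.sqrt beta) * energy) =
  energy ^+ 2 - 2 * energy * (2 * n%:R * Num.sqrt beta).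
  by field; rewrite gt_eqF.
have := ler_wpM2l (ltW E0) hc; have := sqr_ge0 c; nra.
Qed.

End upper.

(** With [e = 1/10] the signal is multiplied by 11 and the noise by 11/10. After clearing [1 / n],
    optimality would force 0.85 [p] - 4 [sqrt beta] below 0.813 [p] + 44 ([beta n] + [n]), and both
    corrections are tiny multiples of [p]. *)
Lemma sdp_solution_far {R : realType} (n p k : nat) (Xi : 'M[R]_(n, p))
    (U : 'cV[R]_n) (z : 'cV[R]_p) (beta : R) (X : 'M[R]_p)
    (K := 2 / (19 / 20) ^+ 2 * p%:R) :
  (0 < n)%N -> sqn z = 1 -> 0 <= beta -> beta <= Num.sqrt (p%:R / n%:R) ->
  150 ^+ 4 * n%:R <= p%:R :> R -> 150 ^+ 4 <= p%:R :> R ->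
  2 * p%:R / Num.sqrt n%:R <= k%:R :> R ->
  (forall v, sqn (Xi^T *m v) <= K * sqn v) ->
  sqn U <= 2 * n%:R -> sqn (Xi *m z) <= 2 * n%:R ->
  85 / 100 * (p%:R * n%:R) <= energy Xi ->
  sdp_solution (n%:R^-1 *: ((data Xi U z beta)^T *m data Xi U z beta)) k X ->
  1 / 3 <= spectral_norm (X - z *m z^T).
Proof.
move=> n0 z1 b0 hb hpn hp hk HK hU hXz hE [[pX tX sX] opt].
have nr : 0 < n%:R :> R by rewrite ltr0n.
have n1 : 1 <= n%:R :> R by rewrite ler1n.
have pr : 0 < p%:R :> R by lra.
have K0 : 0 <= K by rewrite mulr_ge0 // divr_ge0 // sqr_ge0.
have KE : K <= 2217 / 1000 * p%:R by rewrite /K; lra.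
have E0 : 0 < energy Xi by apply: lt_le_trans hE; rewrite !mulr_gt0.
rewrite leNgt; apply/negP => far.
have bX : 2 / 3 < bil X z z.
  have sB : (X - z *m z^T)^T = X - z *m z^T.
    by rewrite linearB /= trmx_mul trmxK; case: pX => ->.
  have := le_lt_trans (bil_le_spectral_norm sB z1) far.
  rewrite -scaleN1r bilD bilZ bil_outer -sqnE z1 expr1n ltr_norml.
  by move=> /andP[h _]; lra.
have feas : sdp_feasible k (candidate Xi).
  apply: (candidate_feasible K0 HK E0 _ hk n0).
  by have := ler_wpM2l (ltW nr) KE; have := mulr_gt0 pr nr; nra.
have := opt _ feas; rewrite !mxdotZl ler_pM2l ?invr_gt0 // => le.
have low := lower_value beta E0 n0 hU hXz.
have e0 : 0 < 1 / 10 :> R by lra.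
have up := upper_value U beta z1 K0 HK e0 pX tX.
have sg := signal_le Xi U z1 b0.
have EN : 85 / 100 * p%:R <= energy Xi / n%:R.
  by rewrite ler_pdivlMr //; lra.
(* From [beta^2 n <= p] one gets [(beta n)^2 <= p n], and [p n <= p^2 / 150^4]. *)
have bn : 150 * 150 * (beta * n%:R) <= p%:R.
  have h2 : beta ^+ 2 * n%:R <= p%:R.
    rewrite -ler_pdivlMr // -[leRHS]sqr_sqrtr ?divr_ge0 //.
    by rewrite ler_sqr ?nnegrE ?sqrtr_ge0.
  have h3 := ler_wpM2l (ltW pr) hpn.
  have h4 := ler_wpM2r (ltW nr) h2.
  have h5 : 0 <= 150 * 150 * (beta * n%:R) by rewrite !mulr_ge0.
  rewrite -ler_sqr ?nnegrE //.
  apply: le_trans (_ : 150 ^+ 4 * (p%:R * n%:R) <= _); last by lra.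
  have -> : (150 * 150 * (beta * n%:R)) ^+ 2 = 150 ^+ 4 * (beta ^+ 2 * n%:R * n%:R) by ring.
  by rewrite ler_wpM2l // exprn_ge0.
have sb : Num.sqrt beta <= 1 + beta.
  have := sqr_sqrtr b0; have := sqrtr_ge0 beta; set s := Num.sqrt beta.
  by move=> s0 <-; have := sqr_ge0 (s - 1); nra.
have bp : 150 * 150 * beta <= p%:R.
  by apply: le_trans bn; rewrite !ler_wpM2l ?mulr_ge0 // ler_peMr.
have h1 : sqn (data Xi U z beta *m z) <= 4 * (beta * n%:R) + 4 * n%:R.
  apply: le_trans sg _; have := ler_wpM2l b0 hU; lra.
have h2 : K * (1 - bil X z z) <= K / 3.
  by rewrite ler_wpM2l //; lra.
move: le low up.
set V := mxdot _ _; set V' := mxdot _ _ => le low up.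
lra.
Qed.

(** * Discretization of the unit ball *)

Section net.
Context {R : realType}.
Variable n : nat.

(* Index of a point of the grid of mesh [1 / (20 * sqrt n)]: sign and modulus
   of each coordinate. *)
Definition grid_index := {ffun 'I_n -> bool * 'I_(20 * n).+1}.

Definition grid_ball : {set grid_index} :=
  [set g : grid_index | (\sum_i (g i).2 ^ 2 <= 400 * n)%N]%SET.

Definition grid_point (g : grid_index) : 'cV[R]_n :=
  \col_i ((-1) ^+ (g i).1 * ((g i).2%:R / (20 * Num.sqrt n%:R))).

Lemma sum_expN2_le m : \sum_(j < m) (2 : R)^-1 ^+ (j ^ 2) <= 2.
Proof.
suff : \sum_(j < m) (2 : R)^-1 ^+ j <= 2.
  apply: le_trans; apply: ler_sum => j _.
  rewrite ler_wiXn2l ?invr_ge0 ?invf_le1 // ?ler1n // expnS expn1.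
  by case: (j : nat) => // k; rewrite leq_pmulr.
suff -> : \sum_(j < m) (2 : R)^-1 ^+ j = 2 - 2 * 2^-1 ^+ m.
  by rewrite lerBlDr lerDl mulr_ge0 // exprn_ge0 // invr_ge0.
elim: m => [|m IH]; first by rewrite big_ord0 expr0 mulr1 subrr.
by rewrite big_ord_recr /= IH exprS; field.
Qed.

(* An index of [grid_ball] has weight at least 1 under
   [2 ^ (400 n) * \prod_i 2 ^ - (g i).2 ^ 2], and the total weight is at most
   [2 ^ (400 n) * 4 ^ n]. *)
Lemma card_grid_ball : #|grid_ball|%:R <= (2 : R) ^+ (402 * n).
Proof.
pose F (i : 'I_n) (x : bool * 'I_(20 * n).+1) : R := 2^-1 ^+ (x.2 ^ 2).
apply: (@le_trans _ _ (2 ^+ (400 * n) * \sum_(g : grid_index) \prod_i F i (g i))).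
  rewrite mulr_sumr -sum1_card natr_sum [leRHS](bigID (mem grid_ball)) /=.
  rewrite -[leLHS]addr0 lerD //; last first.
    apply: sumr_ge0 => g _; rewrite mulr_ge0 ?exprn_ge0 // prodr_ge0 // => i _.
    by rewrite exprn_ge0 // invr_ge0.
  apply: ler_sum => g; rewrite inE => gB.
  rewrite /F prodrXr -ler_pdivrMl ?exprn_gt0 // mulr1 -exprVn.
  by rewrite ler_wiXn2l ?invr_ge0 ?invf_le1 // ?ler1n.
have -> : (402 * n = 400 * n + 2 * n)%N by rewrite -mulnDl.
rewrite exprD ler_pM2l ?exprn_gt0 // -bigA_distr_bigA /=.
apply: le_trans (_ : \prod_(i < n) 2 ^+ 2 <= _); last first.
  by rewrite prodr_const card_ord -exprM.
apply: ler_prod => i _; rewrite sumr_ge0 /=; last first.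
  by move=> x _; rewrite exprn_ge0 // invr_ge0.
rewrite -(pair_bigA _ (fun (b : bool) j => F i (b, j))) /= /F /=.
by rewrite big_bool /=; have := sum_expN2_le (20 * n).+1; lra.
Qed.

Lemma sqn_grid_point g : g \in grid_ball -> sqn (grid_point g) <= 1.
Proof.
have [n0|n0] := posnP n.
  by rewrite /sqn big1 // => i; have := ltn_ord i; rewrite {2}n0.
rewrite inE => gB; have nr : 0 < n%:R :> R by rewrite ltr0n.
have -> : sqn (grid_point g) = (\sum_i (g i).2 ^ 2)%N%:R / (400 * n%:R).
  rewrite natr_sum mulr_suml; apply: eq_bigr => i _.
  rewrite mxE exprMn sqrr_sign mul1r expr_div_n exprMn sqr_sqrtr ?ler0n // natrX.
  by congr (_ / (_ * _)); ring.
rewrite ler_pdivrMr ?mulr_gt0 // mul1r -natrM ler_nat; exact: gB.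
Qed.

(** Moduli are rounded towards zero, so the grid point stays in the ball. Each coordinate moves by
    at most one mesh; the error, enlarged 20 times, is again a vector of the unit ball, which allows
    a self-referential bound on the norm. *)
Lemma grid_rounding (v : 'cV[R]_n) : (0 < n)%N -> sqn v <= 1 ->
  exists2 g, g \in grid_ball & sqn (20 *: (v - grid_point g)) <= 1.
Proof.
move=> n0 v1; have nr : 0 < n%:R :> R by rewrite ltr0n.
pose h : R := 20 * Num.sqrt n%:R.
have h0 : 0 < h by rewrite mulr_gt0 // sqrtr_gt0.
have h2 : h ^+ 2 = 400 * n%:R by rewrite exprMn sqr_sqrtr ?ler0n //; ring.
pose t i := Num.trunc (`|v i 0| * h).
have tP i : (t i)%:R <= `|v i 0| * h < (t i).+1%:R.
  by apply: Num.Theory.truncn_itv; rewrite mulr_ge0 // ltW.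
have ti2 i : ((t i)%:R : R) ^+ 2 <= v i 0 ^+ 2 * h ^+ 2.
  rewrite -[v i 0 ^+ 2]real_normK ?num_real // -exprMn ler_sqr ?nnegrE ?ler0n //.
    by case/andP: (tP i).
  by rewrite mulr_ge0 // ltW.
have vi i : v i 0 ^+ 2 <= 1.
  apply: le_trans v1; rewrite /sqn (bigD1 i) //= lerDl sumr_ge0 // => j _.
  exact: sqr_ge0.
(* Moduli reach at most [20 * sqrt n], hence [20 * n], so [inord] below does not fall back on its
   default value. *)
have tn i : (t i <= 20 * n)%N.
  rewrite -(ler_nat R) -ler_sqr ?nnegrE ?ler0n //; apply: le_trans (ti2 i) _.
  apply: le_trans (ler_wpM2r (sqr_ge0 h) (vi i)) _; rewrite mul1r h2 natrM.
  have n1 : 1 <= n%:R :> R by rewrite ler1n.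
  have := mulr_ge0 (ltW nr) (_ : 0 <= n%:R - 1 :> R); rewrite subr_ge0 => /(_ n1); lra.
pose g : grid_index := [ffun i => (v i 0 < 0, inord (t i))].
have g2 i : (g i).2 = t i :> nat by rewrite ffunE /= inordK // ltnS.
exists g.
  rewrite inE -(ler_nat R) natr_sum natrM -h2; apply: (@le_trans _ _ (sqn v * h ^+ 2)).
    by rewrite mulr_suml; apply: ler_sum => i _; rewrite natrX g2.
  by rewrite -[leRHS]mul1r ler_wpM2r // sqr_ge0.
apply: (@le_trans _ _ (\sum_(i < n) n%:R^-1)); last first.
  by rewrite sumr_const card_ord -(mulr_natl n%:R^-1) divff // gt_eqF.
apply: ler_sum => i _; rewrite !mxE g2 ffunE /=.
have -> : v i 0 = (-1) ^+ (v i 0 < 0)%R * `|v i 0| by rewrite -realEsign ?num_real.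
have -> : (-1) ^+ ((-1) ^+ (v i 0 < 0)%R * `|v i 0| < 0)%R = (-1) ^+ (v i 0 < 0)%R :> R.
  by rewrite -realEsign ?num_real.
rewrite -mulrBr mulrCA exprMn sqrr_sign mul1r.
have -> : n%:R^-1 = (20 / h) ^+ 2.
  by rewrite expr_div_n h2; field; rewrite gt_eqF.
have -> : 20 * (`|v i 0| - (t i)%:R / (20 * Num.sqrt n%:R)) = 20 / h * (`|v i 0| * h - (t i)%:R).
  by rewrite -/h; field; rewrite gt_eqF.
rewrite exprMn -[leRHS]mulr1 ler_wpM2l ?sqr_ge0 //.
by case/andP: (tP i); rewrite -natr1 => ? ?; rewrite expr_le1 //; lra.
Qed.

Lemma sqrt_sqnD m (u v : 'cV[R]_m) :
  Num.sqrt (sqn (u + v)) <= Num.sqrt (sqn u) + Num.sqrt (sqn v).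
Proof.
have h : (u^T *m v) 0 0 <= Num.sqrt (sqn u) * Num.sqrt (sqn v).
  apply: le_trans (ler_norm _) _; rewrite -sqrtrM ?sqn_ge0 // -sqrtr_sqr.
  by rewrite ler_wsqrtr // cauchy_schwarz.
rewrite -ler_sqr ?nnegrE ?addr_ge0 ?sqrtr_ge0 // sqr_sqrtr ?sqn_ge0 //.
rewrite sqrrD !sqr_sqrtr ?sqn_ge0 //.
rewrite -!bil1 bilDl !bilDr (bilC v u) ?trmx1 // {2 3}/bil mulmx1 !bil1.
by rewrite mulr2n; lra.
Qed.

(* With [s] the supremum of [|B v|] over the unit ball, rounding [v] to the
   grid gives [s <= sqrt L + s / 20]. *)
Lemma grid_norm_le m (B : 'M[R]_(m, n)) (L : R) : (0 < n)%N -> 0 <= L ->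
  (forall g, g \in grid_ball -> sqn (B *m grid_point g) <= L) ->
  forall v, sqn (B *m v) <= L / (19 / 20) ^+ 2 * sqn v.
Proof.
move=> n0 L0 BL.
pose E := [set Num.sqrt (sqn (B *m v)) | v in [set v : 'cV[R]_n | sqn v <= 1]].
have ubE : ubound E (Num.sqrt (mxnormS (B^T *m B))).
  move=> _ [v /= v1 <-]; rewrite ler_wsqrtr // -bil_gram.
  apply: le_trans (bil_bound _ _) _; rewrite ler_piMr //.
  by apply: sumr_ge0 => i _; apply: sumr_ge0.
pose s := sup E.
have sE v : sqn v <= 1 -> Num.sqrt (sqn (B *m v)) <= s.
  by move=> v1; apply: (le_sup_nonempty _ ubE); exists v.
have sqn0 : sqn (0 : 'cV[R]_n) <= 1.
  by rewrite /sqn big1 // => i _; rewrite mxE expr0n.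
have s0 : 0 <= s by apply: le_trans (sE _ sqn0); exact: sqrtr_ge0.
have : s <= Num.sqrt L + s / 20.
  apply: ge_sup; first by exists (Num.sqrt (sqn (B *m 0))); exists 0.
  move=> _ [v /= v1 <-]; have [g gB gv] := grid_rounding n0 v1.
  have -> : B *m v = B *m grid_point g + 20^-1 *: (B *m (20 *: (v - grid_point g))).
    by rewrite -scalemxAr scalerA mulVf // scale1r -mulmxDr addrC subrK.
  apply: le_trans (sqrt_sqnD _ _) _; apply: lerD.
    by rewrite ler_wsqrtr // BL.
  rewrite sqnZ sqrtrM ?sqr_ge0 // sqrtr_sqr ger0_norm ?invr_ge0 // mulrC.
  by rewrite ler_wpM2r ?invr_ge0 // sE.
move=> sL v.
have {sL} s2 : s ^+ 2 <= L / (19 / 20) ^+ 2.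
  rewrite ler_pdivlMr ?exprn_gt0 ?divr_gt0 // -exprMn -[leRHS]sqr_sqrtr //.
  by rewrite ler_sqr ?nnegrE ?sqrtr_ge0 ?mulr_ge0 ?divr_ge0 //; lra.
apply: le_trans (ler_wpM2r (sqn_ge0 v) s2).
have [v0|v0] := eqVneq (sqn v) 0.
  by rewrite (sqn_eq0 v0) mulmx0 /sqn !big1 ?mulr0 // => i _; rewrite mxE expr0n.
have vp : 0 < sqn v by rewrite lt0r v0 sqn_ge0.
rewrite -ler_pdivrMr //.
have : sqn ((Num.sqrt (sqn v))^-1 *: v) <= 1.
  by rewrite sqnZ exprVn sqr_sqrtr ?sqn_ge0 // mulVf.
move=> /sE; rewrite -scalemxAr sqnZ exprVn sqr_sqrtr ?sqn_ge0 // mulrC => h.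
rewrite -[leLHS]sqr_sqrtr ?ler_sqr ?nnegrE ?sqrtr_ge0 //.
by rewrite divr_ge0 ?sqn_ge0.
Qed.

End net.

(** * Integration against independent normal variables *)

Section weighted.
Context {R : realType} dY (Y : measurableType dY).
Import HBNNSimple.

(** On the right, [mu], [phi] and [H] occur only through integrals of indicators, and the simple
    functions [g] depend on [f] alone; two such integrals can thus be compared term by term. *)
Lemma weighted_integral_lim d (T : measurableType d)
    (mu : {measure set T -> \bar R}) (phi : T -> Y) (H : T -> R) (f : Y -> R)
    (mf : measurable_fun setT (EFin \o f)) :
  measurable_fun setT phi -> measurable_fun setT H -> (forall x, 0 <= H x) ->
  (forall y, 0 <= f y) ->
  let g := nnsfun_approx measurableT mf in
  (\int[mu]_x (f (phi x) * H x)%:E =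
  limn (fun n => \sum_(k \in range (g n))
     (k%:E * \int[mu]_x (\1_(g n @^-1` [set k]) (phi x) * H x)%:E)))%E.
Proof.
move=> mphi mH H0 f0 g.
transitivity (limn (fun n => \int[mu]_x (g n (phi x) * H x)%:E)%E).
  rewrite -monotone_convergence //.
  - apply: eq_integral => x _; apply/esym/cvg_lim => //.
    rewrite EFinM; under eq_fun do rewrite EFinM.
    apply: cvgeZr => //.
    by apply: (cvg_nnsfun_approx measurableT mf) => // y _; rewrite lee_fin.
  - move=> n; apply/measurable_EFinP/measurable_funM => //.
    exact: measurableT_comp.
  - by move=> n x _; rewrite lee_fin mulr_ge0.
  - move=> x _ a b ab; rewrite lee_fin ler_wpM2r //.
    exact/lefP/nd_nnsfun_approx.
congr (limn _); apply/funext => n.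
have mind k : measurable_fun setT (fun x => \1_(g n @^-1` [set k]) (phi x) * H x).
  apply: measurable_funM => //; apply: measurableT_comp => //.
transitivity (\int[mu]_x \sum_(k \in range (g n))
   (k%:E * (\1_(g n @^-1` [set k]) (phi x) * H x)%:E))%E.
  apply: eq_integral => x _; rewrite fimfunE EFinM -fsumEFin //.
  rewrite muleC ge0_mule_fsumr; last by move=> k; exact: nnfun_muleindic_ge0.
  apply: eq_fsbigr => k _; rewrite -!EFinM; congr EFin; ring.
have nn k x : (0 <= k%:E * (\1_(g n @^-1` [set k]) (phi x) * H x)%:E)%E.
  by rewrite EFinM muleA mule_ge0 // ?lee_fin //; exact: nnfun_muleindic_ge0.
rewrite ge0_integral_fsum //; last first.
  by move=> k; apply/measurable_EFinP/measurable_funM.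
apply: eq_fsbigr => k; rewrite inE => -[y _ <-].
rewrite ge0_integralZl // ?lee_fin //; first exact/measurable_EFinP.
by move=> x _; rewrite lee_fin mulr_ge0.
Qed.

(** The weights let one statement serve three purposes: passing from the normal law to its density,
    from a random variable to its law, and from a product of independent factors to a constant times
    one factor. *)
Lemma eq_weighted_integral d1 (T1 : measurableType d1)
    (mu1 : {measure set T1 -> \bar R}) d2 (T2 : measurableType d2)
    (mu2 : {measure set T2 -> \bar R}) (phi1 : T1 -> Y) (phi2 : T2 -> Y)
    (H1 : T1 -> R) (H2 : T2 -> R) (f : Y -> R) :
  measurable_fun setT phi1 -> measurable_fun setT phi2 ->
  measurable_fun setT H1 -> measurable_fun setT H2 ->
  (forall x, 0 <= H1 x) -> (forall x, 0 <= H2 x) ->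
  (forall B, measurable B -> \int[mu1]_x (\1_B (phi1 x) * H1 x)%:E =
                             \int[mu2]_x (\1_B (phi2 x) * H2 x)%:E)%E ->
  measurable_fun setT f -> (forall y, 0 <= f y) ->
  (\int[mu1]_x (f (phi1 x) * H1 x)%:E = \int[mu2]_x (f (phi2 x) * H2 x)%:E)%E.
Proof.
move=> mp1 mp2 mH1 mH2 H10 H20 E mf f0.
have mf' : measurable_fun setT (EFin \o f) by exact/measurable_EFinP.
rewrite (weighted_integral_lim mu1 mf' mp1 mH1 H10 f0).
rewrite (weighted_integral_lim mu2 mf' mp2 mH2 H20 f0).
by congr (limn _); apply/funext => n; apply: eq_fsbigr => k _; rewrite E.
Qed.
End weighted.

Section normal.
Context {R : realType}.

Lemma integral_normal_prob (m s : R) (f : R -> R) :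
  measurable_fun setT f -> (forall y, 0 <= f y) ->
  (\int[normal_prob m s]_x (f x)%:E =
   \int[lebesgue_measure]_x (f x * normal_pdf m s x)%:E)%E.
Proof.
move=> mf f0.
transitivity (\int[normal_prob m s]_x (f x * 1)%:E)%E.
  by apply: eq_integral => x _; rewrite mulr1.
apply: (eq_weighted_integral (phi1 := id) (phi2 := id) (H1 := fun=> 1)) => //.
- exact: measurable_normal_pdf.
- by move=> x; exact: normal_pdf_ge0.
move=> B mB; under eq_integral do rewrite mulr1.
rewrite integral_indic // setIT /= /normal_prob [LHS]integral_mkcond.
apply: eq_integral => x _; rewrite /patch indicE.
by case: (x \in B); rewrite ?mul1r ?mul0r.
Qed.

(* Completing the square turns the integrand times the standard normal density
   into a multiple of the normal density of mean [s ^+ 2 * b] and deviation [s]. *)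
Lemma normal_expR (s b : R) : 0 < s ->
  (\int[normal_prob 0 1]_x (expR (b * x + (1 - s ^- 2) / 2 * x ^+ 2))%:E =
   (s * expR (s ^+ 2 * b ^+ 2 / 2))%:E)%E.
Proof.
move=> s0; have sn0 : s != 0 by rewrite gt_eqF.
rewrite integral_normal_prob; first last.
- by move=> y; exact: expR_ge0.
- apply: measurableT_comp => //; apply: measurable_funD; first exact: measurable_funM.
  by apply: measurable_funM => //; exact: exprn_measurable.
transitivity (\int[lebesgue_measure]_x
   ((s * expR (s ^+ 2 * b ^+ 2 / 2))%:E * (normal_pdf (s ^+ 2 * b) s x)%:E))%E.
  apply: eq_integral => x _; rewrite -EFinM; congr EFin.
  rewrite !normal_pdfE ?oner_eq0 // /normal_fun.
  have -> : normal_peak 1 = s * normal_peak s :> R.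
    rewrite /normal_peak expr1n mul1r -mulrnAr [in RHS]sqrtrM ?sqr_ge0 //.
    by rewrite sqrtr_sqr gtr0_norm // invfM mulrA divff // mul1r.
  set e1 := expR _; set e2 := expR _; set e3 := expR _; set e4 := expR _.
  have e12 : e1 * e2 = e3 * e4.
    by rewrite -!expRD; congr expR; field.
  have -> : e1 * (s * normal_peak s * e2) = s * normal_peak s * (e1 * e2) by ring.
  by rewrite e12; ring.
rewrite ge0_integralZl_EFin //.
- by rewrite integral_normal_pdf mule1.
- by move=> x _; rewrite lee_fin; exact: normal_pdf_ge0.
- by apply/measurable_EFinP; exact: measurable_normal_pdf.
- by rewrite mulr_ge0 ?expR_ge0 // ltW.
Qed.

End normal.

Section independence.
Context {R : realType} {d : measure_display} {T : measurableType d}.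
Variable P : probability T R.
Variables (I : finType) (Z : I -> {RV P >-> R}).
Hypothesis indep : mutually_independent Z.

Lemma integral_indic_rv (X : {RV P >-> R}) (B : set R) : measurable B ->
  (\int[P]_w (\1_B (X w))%:E = P (X @^-1` B))%E.
Proof.
move=> mB; rewrite -[X @^-1` B]setIT -integral_indic //.
exact: measurable_funPTI.
Qed.

(** Induction on a list of indices outside of which every factor is an indicator. With an empty list
    this is independence of events. Otherwise [eq_weighted_integral] reduces the factor at the head
    to an indicator, the remaining product being the weight. *)
Lemma integral_prod_independent (f : I -> R -> R) (m : I -> R) :
  (forall i, measurable_fun setT (f i)) -> (forall i y, 0 <= f i y) ->
  (forall i, \int[P]_w (f i (Z i w))%:E = (m i)%:E)%E ->
  (\int[P]_w (\prod_i f i (Z i w))%:E = (\prod_i m i)%:E)%E.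
Proof.
have gen (s : seq I) : forall (f : I -> R -> R) (m : I -> R),
  (forall i, measurable_fun setT (f i)) -> (forall i y, 0 <= f i y) ->
  (forall i, \int[P]_w (f i (Z i w))%:E = (m i)%:E)%E ->
  (forall i, i \notin s -> exists2 B, measurable B & f i = \1_B) ->
  (\int[P]_w (\prod_i f i (Z i w))%:E = (\prod_i m i)%:E)%E.
  elim: s => [|i0 s IH] {}f {}m mf f0 fm fs.
    have /choice[B BP] i : exists B, measurable B /\ f i = \1_B.
      by have [//|B ? ?] := fs i; exists B.
    have mB i : measurable (B i) by case: (BP i).
    have PB i : P (Z i @^-1` B i) = (m i)%:E.
      by rewrite -fm; case: (BP i) => _ ->; rewrite integral_indic_rv.
    transitivity (\int[P]_w (\1_(\bigcap_(i in [set` [set: I]%SET]) (Z i @^-1` B i)) w)%:E)%E.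
      apply: eq_integral => w _; congr EFin.
      under eq_bigr => i _ do rewrite (BP i).2 indicE.
      rewrite indicE; case: (boolP (w \in _)) => [|].
        rewrite inE => wB; rewrite big1 // => i _.
        by rewrite mem_set //; apply: wB; rewrite /= finset.in_setT.
      rewrite notin_setE => /existsNP[i] /not_implyP[_ nB].
      by rewrite (bigD1 i) //= memNset // mul0r.
    rewrite integral_indic //; last first.
      apply: fin_bigcap_measurable => // i _.
      exact: measurable_funPTI.
    rewrite setIT; apply: etrans; first exact: (indep [set: I]%SET mB).
    transitivity (\prod_i P (Z i @^-1` B i))%E.
      by apply: eq_bigl => i; rewrite finset.in_setT.
    rewrite (big_morph EFin EFinM erefl); apply: eq_bigr => i _; exact: PB.
  have mp i : measurable_fun setT (fun w => f i (Z i w)) by exact: measurableT_comp.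
  pose H w := \prod_(i | i != i0) f i (Z i w).
  pose c := \prod_(i | i != i0) m i.
  have m0 i : 0 <= m i.
    by rewrite -lee_fin -fm integral_ge0 // => w _; rewrite lee_fin.
  have c0 : 0 <= c by apply: prodr_ge0.
  transitivity (\int[P]_w (f i0 (Z i0 w) * H w)%:E)%E.
    by apply: eq_integral => w _; rewrite (bigD1 i0).
  rewrite (@eq_weighted_integral _ _ _ _ _ P _ _ P (Z i0) (Z i0) H (fun=> c)) //.
  - under eq_integral do rewrite mulrC EFinM.
    rewrite ge0_integralZl_EFin //; first last.
    + by apply/measurable_EFinP.
    + by move=> w _; rewrite lee_fin.
    by rewrite fm -EFinM [in RHS](bigD1 i0) //= mulrC.
  - rewrite /H; under eq_fun do rewrite -big_filter.
    by apply: measurable_prod => i _; exact: mp.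
  - by move=> w; apply: prodr_ge0.
  move=> B mB.
  pose f' i := if i == i0 then \1_B else f i.
  have PBfin : P (Z i0 @^-1` B) \is a fin_num.
    by rewrite fin_num_measure //; exact: measurable_funPTI.
  pose m' i := if i == i0 then fine (P (Z i0 @^-1` B)) else m i.
  have m'0 : m' i0 = fine (P (Z i0 @^-1` B)) by rewrite /m' eqxx.
  have f'0 : f' i0 = \1_B by rewrite /f' eqxx.
  have := IH f' m'; rewrite (bigD1 i0) //= m'0 => IH'.
  transitivity (fine (P (Z i0 @^-1` B)) * c)%:E.
    rewrite /c (eq_bigr m'); last by move=> i ii0; rewrite /m' (negbTE ii0).
    rewrite -IH'.
    - apply: eq_integral => w _; congr EFin; rewrite [RHS](bigD1 i0) //= f'0.
      by congr (_ * _); apply: eq_bigr => i ii0; rewrite /f' (negbTE ii0).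
    - by move=> i; rewrite /f'; case: ifP => _ //; exact: measurable_indic.
    - by move=> i y; rewrite /f'; case: ifP.
    - move=> i; rewrite /f' /m'; case: eqP => [->|_]; last exact: fm.
      by rewrite integral_indic_rv // fineK.
    - move=> i js; rewrite /f'; case: eqP => [_|/eqP ii0]; first by exists B.
      by apply: fs; rewrite inE negb_or ii0.
  under [RHS]eq_integral do rewrite mulrC EFinM.
  rewrite ge0_integralZl_EFin // ?integral_indic_rv ?fineK //.
    by rewrite mulrC EFinM fineK.
  by apply/measurable_EFinP; apply: measurableT_comp.
by move=> mf f0 fm; apply: (gen (enum I)) => // i; rewrite mem_enum.
Qed.

End independence.

Section gaussian.
Context {R : realType} {d : measure_display} {T : measurableType d}.
Variable P : probability T R.

Lemma integral_standard_normal (X : {RV P >-> R}) (f : R -> R) :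
  standard_normal X -> measurable_fun setT f -> (forall y, 0 <= f y) ->
  (\int[P]_w (f (X w))%:E = \int[normal_prob 0 1]_x (f x)%:E)%E.
Proof.
move=> NX mf f0.
transitivity (\int[P]_w (f (X w) * 1)%:E)%E.
  by apply: eq_integral => w _; rewrite mulr1.
transitivity (\int[normal_prob 0 1]_x (f x * 1)%:E)%E; last first.
  by apply: eq_integral => w _; rewrite mulr1.
have -> // := @eq_weighted_integral _ _ _ _ _ P _ _ (normal_prob 0 1) X id
  (fun=> 1) (fun=> 1) f.
move=> B mB.
under eq_integral do rewrite mulr1.
under [RHS]eq_integral do rewrite mulr1.
by rewrite integral_indic_rv // [RHS]integral_indic // setIT; exact: NX.
Qed.

Variables (I : finType) (Z : I -> {RV P >-> R}).
Hypothesis indep : mutually_independent Z.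
Hypothesis normalZ : forall i, standard_normal (Z i).

Lemma measurable_linear_form (b : I -> R) :
  measurable_fun setT (fun w => \sum_i b i * Z i w).
Proof. by apply: measurable_sum => i; exact: measurable_funM. Qed.

Lemma mgf_linear_form (b : I -> R) :
  (\int[P]_w (expR (\sum_i b i * Z i w))%:E
   = (expR ((\sum_i b i ^+ 2) / 2))%:E)%E.
Proof.
under eq_integral do rewrite expR_sum.
rewrite (@integral_prod_independent _ _ _ P _ Z indep (fun i x => expR (b i * x))
  (fun i => expR (b i ^+ 2 / 2))).
- by rewrite -expR_sum mulr_suml.
- by move=> i; apply: measurableT_comp => //; exact: measurable_funM.
- by move=> i y; exact: expR_ge0.
- move=> i; rewrite (@integral_standard_normal (Z i) (fun x => expR (b i * x))) //.
  + under eq_integral => x _.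
      have -> : b i * x = b i * x + (1 - 1 ^- 2) / 2 * x ^+ 2.
        by rewrite expr1n invr1 subrr mul0r mul0r addr0.
      over.
    by rewrite normal_expR // expr1n !mul1r.
  + by apply: measurableT_comp => //; exact: measurable_funM.
Qed.

(* [expR (3 / 8 * y ^+ 2)] is the average of [expR (Num.sqrt (3 / 4) * y * x)]
   over a standard normal [x]; by Tonelli this trades one square against a
   perturbation of the linear form. *)
Lemma mgf_squares_le (a : nat -> I -> R) (m : nat) :
  (forall j, (j < m)%N -> \sum_i a j i ^+ 2 <= 1) ->
  (forall j l, (j < l < m)%N -> \sum_i a l i * a j i = 0) ->
  forall b : I -> R, (forall j, (j < m)%N -> \sum_i b i * a j i = 0) ->
  (\int[P]_w (expR (\sum_i b i * Z i w
      + 3 / 8 * \sum_(j < m) (\sum_i a j i * Z i w) ^+ 2))%:E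
   <= (2 ^+ m * expR ((\sum_i b i ^+ 2) / 2))%:E)%E.
Proof.
elim: m => [|m IH] a1 aa b ba.
  under eq_integral do rewrite big_ord0 mulr0 addr0.
  by rewrite mgf_linear_form expr0 mul1r.
have aa' j l : (j < l < m)%N -> \sum_i a l i * a j i = 0.
  by move=> /andP[jl lm]; apply: aa; rewrite jl ltnW.
have {}IH := IH (fun j jm => a1 j (ltnW jm)) aa'.
pose c : R := Num.sqrt (3 / 4).
have c2 : c ^+ 2 = 3 / 4 by rewrite sqr_sqrtr //; lra.
pose Y w := \sum_i a m i * Z i w.
pose A w := \sum_i b i * Z i w + 3 / 8 * \sum_(j < m) (\sum_i a j i * Z i w) ^+ 2.
have mY : measurable_fun setT Y by exact: measurable_linear_form.
have mA : measurable_fun setT A.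
  apply: measurable_funD; first exact: measurable_linear_form.
  apply: measurable_funM => //; apply: measurable_sum => j.
  by apply: measurable_funX; exact: measurable_linear_form.
pose F (wx : T * R) := (expR (A wx.1 + c * Y wx.1 * wx.2))%:E.
have mF : measurable_fun setT F.
  apply/measurable_EFinP; apply: measurableT_comp => //.
  apply: measurable_funD; first exact: measurableT_comp.
  by apply: measurable_funM => //; apply: measurable_funM => //; exact: measurableT_comp.
have F0 wx : (0 <= F wx)%E by rewrite lee_fin expR_ge0.
have -> : (\int[P]_w (expR (\sum_i b i * Z i w
      + 3 / 8 * \sum_(j < m.+1) (\sum_i a j i * Z i w) ^+ 2))%:E =
  \int[P]_w \int[normal_prob 0 1]_x F (w, x))%E.
  apply: eq_integral => w _; rewrite big_ord_recr /= mulrDr addrA -/(A w) -/(Y w).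
  under eq_integral => x _.
    rewrite /F /= expRD EFinM.
    have -> : c * Y w * x = c * Y w * x + (1 - 1 ^- 2) / 2 * x ^+ 2.
      by rewrite expr1n invr1 subrr mul0r mul0r addr0.
    over.
  rewrite ge0_integralZl_EFin ?expR_ge0 //; last first.
  - apply/measurable_EFinP; apply: measurableT_comp => //.
    apply: measurable_funD; first exact: measurable_funM.
    by apply: measurable_funM => //; exact: exprn_measurable.
  rewrite normal_expR // expr1n !mul1r exprMn c2 -EFinM -expRD.
  by congr (expR _)%:E; field.
rewrite fubini_tonelli //.
apply: (@le_trans _ _ (\int[normal_prob 0 1]_x
   ((2 ^+ m * expR ((\sum_i b i ^+ 2) / 2))%:E *
    (expR (0 * x + (1 - 2 ^- 2) / 2 * x ^+ 2))%:E))%E).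
  apply: ge0_le_integral => //.
  - by move=> x _; apply: integral_ge0.
  - exact: (measurable_fun_fubini_tonelli_G F).
  - apply/measurable_EFinP/measurable_funM => //; apply: measurableT_comp => //.
    apply: measurable_funD => //.
    by apply: measurable_funM => //; exact: exprn_measurable.
  (* The perturbed form remains orthogonal to the earlier ones, and by Pythagoras its exponent grows
     by at most [3 / 8 * x ^+ 2]. The normal expectation of that exponential is 2, the new factor in
     the bound. *)
  move=> x _; pose b' i := b i + c * x * a m i.
  have -> : (\int[P]_w F (w, x))%E = (\int[P]_w (expR (\sum_i b' i * Z i w
      + 3 / 8 * \sum_(j < m) (\sum_i a j i * Z i w) ^+ 2))%:E)%E.
    apply: eq_integral => w _; rewrite /F /A /Y /=; congr (expR _)%:E.
    rewrite addrAC; congr (_ + _); rewrite mulrAC mulr_sumr -big_split.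
    by apply: eq_bigr => i _; rewrite /b' /=; ring.
  apply: le_trans (IH b' _) _.
    move=> j jm; under eq_bigr do rewrite /b' mulrDl -mulrA.
    rewrite big_split /= -mulr_sumr ba ?(leqW jm) // (aa j m) ?jm ?ltnSn //.
    by rewrite mulr0 addr0.
  rewrite -EFinM lee_fin -[leRHS]mulrA ler_pM2l ?exprn_gt0 // -expRD ler_expR.
  have -> : \sum_i b' i ^+ 2 = \sum_i b i ^+ 2 + 3 / 4 * x ^+ 2 * \sum_i a m i ^+ 2.
    have -> : \sum_i b' i ^+ 2 = \sum_i b i ^+ 2 + 2 * c * x * (\sum_i b i * a m i)
       + (c * x) ^+ 2 * \sum_i a m i ^+ 2.
      rewrite !mulr_sumr -!big_split; apply: eq_bigr => i _ /=; rewrite /b'; ring.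
    by rewrite ba // mulr0 addr0 exprMn c2.
  have := ler_wpM2l (sqr_ge0 x) (a1 m (ltnSn m)); lra.
rewrite ge0_integralZl_EFin //.
- by rewrite normal_expR // expr0n mulr0 mul0r expR0 mulr1 -EFinM exprS lee_fin; lra.
- apply/measurable_EFinP; apply: measurableT_comp => //.
  apply: measurable_funD => //.
  by apply: measurable_funM => //; exact: exprn_measurable.
Qed.

End gaussian.

(** * Tail bounds *)

Section tails.
Context {R : realType} {d : measure_display} {T : measurableType d}.
Variable P : probability T R.

Lemma measurable_lt_set (f g : T -> R) : measurable_fun setT f ->
  measurable_fun setT g -> measurable [set w | f w < g w].
Proof.
move=> mf mg; rewrite -[X in measurable X]setTI.
exact: (measurable_fun_ltr mf mg measurableT (Y := [set true])).
Qed.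

Lemma prob_gt0_le (g : T -> R) : measurable_fun setT g ->
  (P [set w | 0 < g w]%R <= \int[P]_w (expR (g w))%:E)%E.
Proof.
move=> mg; have mA : measurable [set w | 0 < g w] by exact: measurable_lt_set.
rewrite -[X in P X]setIT -integral_indic //; apply: ge0_le_integral => //.
- by apply/measurable_EFinP; exact: measurable_indic.
- by apply/measurable_EFinP; exact: measurableT_comp.
move=> w _; rewrite lee_fin indicE; case: (boolP (w \in _)) => [|_]; last exact: expR_ge0.
by rewrite inE /= => gw; rewrite -[1]expR0 ler_expR ltW.
Qed.

Variables (I : finType) (Z : I -> {RV P >-> R}).
Hypothesis indep : mutually_independent Z.
Hypothesis normalZ : forall i, standard_normal (Z i).

Lemma sum_squares_upper_tail m (a : 'I_m -> I -> R) :
  (forall j, \sum_i a j i ^+ 2 <= 1) ->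
  (forall j l, j != l -> \sum_i a l i * a j i = 0) ->
  (P [set w | 2 * m%:R < \sum_j (\sum_i a j i * Z i w) ^+ 2]%R
    <= ((2 * expR (- (3 / 4))) ^+ m)%:E)%E.
Proof.
move=> a1 aa.
(* The exponential moment bound is proved by induction on [m] and needs forms indexed by [nat];
   beyond [m] they are set to zero. *)
pose a' (j : nat) i := if insub j is Some o then a o i else 0.
have a'E (j : 'I_m) i : a' j i = a j i by rewrite /a' valK.
pose S w := \sum_j (\sum_i a j i * Z i w) ^+ 2.
have mS : measurable_fun setT S.
  by apply: measurable_sum => j; apply: measurable_funX; exact: measurable_linear_form.
have -> : [set w | 2 * m%:R < \sum_j (\sum_i a j i * Z i w) ^+ 2] =
    [set w | 0 < 3 / 8 * S w - 3 / 4 * m%:R].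
  by apply/seteqP; split => w /=; rewrite -/(S w); lra.
apply: le_trans (prob_gt0_le _) _.
  by apply: measurable_funB => //; exact: measurable_funM.
under eq_integral do rewrite addrC expRD EFinM.
rewrite ge0_integralZl_EFin ?expR_ge0 //; last first.
  by apply/measurable_EFinP; apply: measurableT_comp => //; exact: measurable_funM.
have := @mgf_squares_le _ _ _ P I Z indep normalZ a' m _ _ (fun=> 0) _.
have -> : (\int[P]_w (expR (\sum_i 0 * Z i w + 3 / 8 *
   \sum_(j < m) (\sum_i a' j i * Z i w) ^+ 2))%:E = \int[P]_w (expR (3 / 8 * S w))%:E)%E.
  apply: eq_integral => w _; congr (expR _)%:E.
  rewrite big1 ?add0r; last by move=> i _; rewrite mul0r.
  by congr (_ * _); apply: eq_bigr => j _; under eq_bigr do rewrite a'E.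
have -> : \sum_(i : I) (0 : R) ^+ 2 = 0 by rewrite big1 // => i _; rewrite expr0n.
rewrite mul0r expR0 mulr1 => h.
have -> : (2 * expR (- (3 / 4))) ^+ m = expR (- (3 / 4 * m%:R)) * 2 ^+ m :> R.
  by rewrite exprMn -expRM_natl mulrC; congr (expR _ * _); ring.
rewrite EFinM; apply: lee_wpmul2l; first by rewrite lee_fin expR_ge0.
apply: h.
- by move=> j jm; rewrite -[j]/(val (Ordinal jm)); under eq_bigr do rewrite a'E.
- move=> j l /andP[jl lm]; have jm := ltn_trans jl lm.
  rewrite -[j]/(val (Ordinal jm)) -[l]/(val (Ordinal lm)).
  by under eq_bigr do rewrite !a'E; apply: aa; rewrite -val_eqE /= ltn_eqF.
- by move=> j _; rewrite big1 // => i _; rewrite mul0r.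
Qed.

Lemma sum_squares_lower_tail (S : {set I}) :
  (P [set w | \sum_(i in S) Z i w ^+ 2 < 85 / 100 * #|S|%:R]%R
    <= ((9 / 10 * expR (19 / 162 * (85 / 100))) ^+ #|S|)%:E)%E.
Proof.
pose Q w := \sum_(i in S) Z i w ^+ 2.
have mQ : measurable_fun setT Q.
  rewrite /Q; under eq_fun do rewrite -big_filter.
  by apply: measurable_sum => i; exact: measurable_funX.
have -> : [set w | \sum_(i in S) Z i w ^+ 2 < 85 / 100 * #|S|%:R] =
    [set w | 0 < 19 / 162 * (85 / 100 * #|S|%:R - Q w)].
  by apply/seteqP; split => w /=; rewrite -/(Q w); lra.
apply: le_trans (prob_gt0_le _) _.
  by apply: measurable_funM => //; exact: measurable_funB.
(* The product formula wants a factor at every index, hence 1 outside [S]. Inside, this is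
   [normal_expR] with [s = 9 / 10] and [b = 0]. *)
pose f i (y : R) := if i \in S then expR (0 * y + (1 - (9 / 10) ^- 2) / 2 * y ^+ 2) else 1.
pose c : R := 19 / 162 * (85 / 100).
have E w : expR (19 / 162 * (85 / 100 * #|S|%:R - Q w)) =
    expR c ^+ #|S| * \prod_i f i (Z i w).
  rewrite -big_mkcond /= -expR_sum -expRM_natl -expRD; congr expR.
  have -> : \sum_(i in S) (0 * Z i w + (1 - (9 / 10) ^- 2) / 2 * Z i w ^+ 2)
    = - (19 / 162) * Q w.
    by rewrite mulr_sumr; apply: eq_bigr => i _; field.
  by rewrite /c; ring.
have mf i : measurable_fun setT (f i).
  rewrite /f; case: (i \in S) => //; apply: measurableT_comp => //.
  by apply: measurable_funD; apply: measurable_funM => //; exact: measurable_funX.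
have f0 i y : 0 <= f i y by rewrite /f; case: (i \in S) => //; exact: expR_ge0.
under eq_integral do rewrite E EFinM.
rewrite ge0_integralZl_EFin ?exprn_ge0 ?expR_ge0 //; last first.
  apply/measurable_EFinP; apply: measurable_prod => i _; exact: measurableT_comp.
  by move=> w _; rewrite lee_fin prodr_ge0.
rewrite (@integral_prod_independent _ _ _ P _ Z indep f
   (fun i => if i \in S then 9 / 10 else 1)) //.
  rewrite -big_mkcond prodr_const -EFinM -exprMn lee_fin mulrC; exact: lexx.
move=> i; rewrite (@integral_standard_normal _ _ _ P (Z i) (f i)) //.
rewrite /f; case: (i \in S).
  by rewrite normal_expR ?divr_gt0 // expr0n mulr0 mul0r expR0 mulr1.
by rewrite integral_cst // mul1e; exact: probability_setT.
Qed.

Lemma prob_bigsetU_le (J : eqType) (s : seq J) (B : J -> set T) (c : R) :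
  (forall j, measurable (B j)) -> (forall j, j \in s -> P (B j) <= c%:E)%E ->
  (P (\big[setU/set0]_(j <- s) B j) <= ((size s)%:R * c)%:E)%E.
Proof.
move=> mB; elim: s => [|j s IH] Bc; first by rewrite big_nil measure0 mul0r.
rewrite big_cons /= -natr1 mulrDl mul1r addrC EFinD.
apply: le_trans (measureU2 _ _ _) _ => //; first exact: bigsetU_measurable.
apply: leeD; first by apply: Bc; rewrite mem_head.
by apply: IH => l ls; apply: Bc; rewrite inE ls orbT.
Qed.

End tails.

(* Chernoff rates.  With exponent [3 / 8 = (1 - 2 ^- 2) / 2] the exponential
   moment of a squared standard normal is 2, and the upper threshold is 2; with
   exponent [- (19 / 162) = (1 - (9 / 10) ^- 2) / 2] it is [9 / 10], and the
   lower threshold is [85 / 100]. *)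
Section constants.
Context {R : realType}.

Lemma upper_rate_ge0 : 0 <= 2 * expR (- (3 / 4)) :> R.
Proof. by rewrite mulr_ge0 ?expR_ge0. Qed.

(** Cutting 3/4 into 16 slices makes [1 + x <= expR x] sharp enough. The target 41/42 suits
    Bernoulli: [(1 + 1/41)^41 >= 2], so 41 factors halve the bound. *)
Lemma upper_rate_le : 2 * expR (- (3 / 4)) <= 41 / 42 :> R.
Proof.
have h : (67 / 64) ^+ 16 <= expR (3 / 4) :> R.
  have -> : 3 / 4 = 16%:R * (3 / 64) :> R by field.
  rewrite expRM_natl lerXn2r ?nnegrE ?expR_ge0 ?divr_ge0 //.
  by apply: le_trans (expR_ge1Dx _); lra.
rewrite expRN ler_pdivrMr ?expR_gt0 //; lra.
Qed.

Lemma upper_rate_lt1 : 2 * expR (- (3 / 4)) < 1 :> R.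
Proof. by apply: le_lt_trans upper_rate_le _; lra. Qed.

Lemma upper_rate_exp41 : (2 * expR (- (3 / 4))) ^+ 41 <= 2^-1 :> R.
Proof.
have bern (m : nat) (x : R) : 0 <= x -> 1 + m%:R * x <= (1 + x) ^+ m.
  move=> x0; elim: m => [|m IH]; first by rewrite mul0r addr0.
  have h : 0 <= m%:R * x * x by rewrite !mulr_ge0.
  rewrite exprS; apply: le_trans (ler_wpM2l _ IH); last by lra.
  rewrite -natr1; lra.
apply: le_trans (_ : (41 / 42) ^+ 41 <= _).
  by rewrite lerXn2r ?nnegrE ?upper_rate_ge0 ?upper_rate_le // divr_ge0.
have -> : 41 / 42 = (1 + 41^-1)^-1 :> R by field.
rewrite exprVn lef_pV2 ?posrE ?exprn_gt0 ?addr_gt0 ?invr_gt0 //.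
have -> : 2 = 1 + 41%:R * 41^-1 :> R by field.
by apply: bern; rewrite invr_ge0.
Qed.

(** The exponent is just below 1/10, so the tangent bound [1 - x <= expR (- x)] already beats
    9/10. *)
Lemma lower_rate_lt1 : 9 / 10 * expR (19 / 162 * (85 / 100)) < 1 :> R.
Proof.
have h := expR_ge1Dx (- (19 / 162 * (85 / 100)) : R).
rewrite -ltr_pdivlMl ?divr_gt0 // mulr1 -[X in expR X]opprK expRN.
rewrite ltf_pV2 ?posrE ?expR_gt0 ?divr_gt0 //; apply: lt_le_trans h; lra.
Qed.

End constants.

(** * The spiked model *)

Section model.
Context {R : realType} {d : measure_display} {T : measurableType d}.
Variables (P : probability T R) (n p : nat).
Variables (u : 'I_n -> {RV P >-> R}) (xi : 'I_n -> 'I_p -> {RV P >-> R}).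
Hypothesis model : gaussian_model u xi.

Definition noise (w : T) : 'M[R]_(n, p) := \matrix_(i, j) xi i j w.
Definition factors (w : T) : 'cV[R]_n := \col_i u i w.

Lemma sample_covE (beta : R) (z : 'cV[R]_p) w : sample_cov beta z u xi w =
  n%:R^-1 *: ((data (noise w) (factors w) z beta)^T *m
              data (noise w) (factors w) z beta).
Proof.
rewrite /sample_cov; congr (_ *: _); apply/matrixP => j l.
rewrite summxE mxE; apply: eq_bigr => i _.
by rewrite !mxE !big_ord1 !mxE; ring.
Qed.

Lemma sum_joint_index (F : 'I_n + 'I_n * 'I_p -> R) :
  \sum_s F s = \sum_i F (inl i) + \sum_i \sum_j F (inr (i, j)).
Proof.
rewrite big_sumType /=; congr (_ + _).
by rewrite (pair_bigA _ (fun i j => F (inr (i, j)))); apply: eq_bigr => -[].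
Qed.

Let q : R := 2 * expR (- (3 / 4)).

Lemma sum_delta m (F : 'I_m -> R) (k : 'I_m) (b : 'I_m -> R) :
  (forall j, F j = if j == k then b j else 0) -> \sum_j F j = b k.
Proof.
move=> FE; rewrite (bigD1 k) //= big1 ?addr0 ?FE ?eqxx // => j jk.
by rewrite FE (negbTE jk).
Qed.

(** Coordinate [j] only involves column [j] of the noise. The coefficient vectors thus have disjoint
    supports, hence are orthogonal, and each has squared norm [sqn v]. *)
Lemma noise_tr_upper_tail (v : 'cV[R]_n) : sqn v <= 1 ->
  (P [set w | 2 * p%:R < sqn ((noise w)^T *m v)]%R <= (q ^+ p)%:E)%E.
Proof.
move=> v1; have [normalZ indep] := model.
pose a (j : 'I_p) (s : 'I_n + 'I_n * 'I_p) : R :=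
  if s is inr ij then if ij.2 == j then v ij.1 0 else 0 else 0.
have aE w : sqn ((noise w)^T *m v) = \sum_j (\sum_s a j s * joint_family u xi s w) ^+ 2.
  apply: eq_bigr => j _; rewrite sum_joint_index big1 ?add0r /=; last by move=> i _; rewrite mul0r.
  rewrite mxE; congr (_ ^+ 2); apply: eq_bigr => i _.
  rewrite (@sum_delta _ _ j (fun l => v i 0 * xi i l w)) ?mxE ?mxE 1?mulrC // => l.
  by case: eqP => // _; rewrite mul0r.
under eq_set do rewrite aE; apply: (sum_squares_upper_tail indep normalZ).
- move=> j; rewrite sum_joint_index big1 ?add0r /=; last by move=> i _; rewrite expr0n.
  apply: le_trans v1; apply: ler_sum => i _.
  rewrite (@sum_delta _ _ j (fun=> v i 0 ^+ 2)) // => l.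
  by case: eqP => // _; rewrite expr0n.
- move=> j l jl; rewrite big1 // => -[i|[i k]] _ /=; first by rewrite mul0r.
  by case: (eqVneq k j) => [->|]; rewrite ?mulr0 // (negbTE jl) mul0r.
Qed.

Lemma noise_upper_tail (z : 'cV[R]_p) : sqn z <= 1 ->
  (P [set w | 2 * n%:R < sqn (noise w *m z)]%R <= (q ^+ n)%:E)%E.
Proof.
move=> z1; have [normalZ indep] := model.
pose a (i : 'I_n) (s : 'I_n + 'I_n * 'I_p) : R :=
  if s is inr ij then if ij.1 == i then z ij.2 0 else 0 else 0.
have aE w : sqn (noise w *m z) = \sum_i (\sum_s a i s * joint_family u xi s w) ^+ 2.
  apply: eq_bigr => i _; rewrite sum_joint_index big1 ?add0r /=; last by move=> k _; rewrite mul0r.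
  rewrite mxE exchange_big; congr (_ ^+ 2); apply: eq_bigr => j _ /=.
  rewrite (@sum_delta _ _ i (fun l => z j 0 * xi l j w)) ?mxE 1?mulrC // => l.
  by case: eqP => // _; rewrite mul0r.
under eq_set do rewrite aE; apply: (sum_squares_upper_tail indep normalZ).
- move=> i; rewrite sum_joint_index big1 ?add0r /=; last by move=> k _; rewrite expr0n.
  rewrite exchange_big; apply: le_trans z1; apply: ler_sum => j _ /=.
  rewrite (@sum_delta _ _ i (fun=> z j 0 ^+ 2)) // => l.
  by case: eqP => // _; rewrite expr0n.
- move=> i l il; rewrite big1 // => -[k|[k j]] _ /=; first by rewrite mul0r.
  by case: (eqVneq k i) => [->|]; rewrite ?mulr0 // (negbTE il) mul0r.
Qed.

Lemma factors_upper_tail :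
  (P [set w | 2 * n%:R < sqn (factors w)]%R <= (q ^+ n)%:E)%E.
Proof.
have [normalZ indep] := model.
pose a (i : 'I_n) (s : 'I_n + 'I_n * 'I_p) : R :=
  if s is inl k then if k == i then 1 else 0 else 0.
have aE w : sqn (factors w) = \sum_i (\sum_s a i s * joint_family u xi s w) ^+ 2.
  apply: eq_bigr => i _; rewrite sum_joint_index addrC big1 ?add0r /=; last first.
    by move=> k _; rewrite big1 // => j _; rewrite mul0r.
  rewrite (@sum_delta _ _ i (fun l => u l w)) ?mxE // => l.
  by case: eqP; rewrite ?mul1r ?mul0r.
under eq_set do rewrite aE; apply: (sum_squares_upper_tail indep normalZ).
- move=> i; rewrite sum_joint_index addrC big1 ?add0r /=; last first.
    by move=> k _; rewrite big1 // => j _; rewrite expr0n.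
  rewrite (@sum_delta _ _ i (fun=> 1)) // => l.
  by case: eqP => // _; rewrite ?expr1n ?expr0n.
- move=> i l il; rewrite big1 // => -[k|[k j]] _ /=; last by rewrite mul0r.
  by case: (eqVneq k i) => [->|]; rewrite ?mulr0 // (negbTE il) mul0r.
Qed.

Lemma energy_lower_tail :
  (P [set w | energy (noise w) < 85 / 100 * (p%:R * n%:R)]%R
    <= ((9 / 10 * expR (19 / 162 * (85 / 100))) ^+ (n * p))%:E)%E.
Proof.
have [normalZ indep] := model.
pose S : {set 'I_n + 'I_n * 'I_p} := [set inr x | x : 'I_n * 'I_p]%SET.
have inrI : injective (@inr 'I_n ('I_n * 'I_p)) by move=> x y [].
have cS : #|S| = (n * p)%N by rewrite card_imset // card_prod !card_ord.
have EE w : energy (noise w) = \sum_(s in S) joint_family u xi s w ^+ 2.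
  rewrite big_imset /=; last by move=> ? ? _ _; exact: inrI.
  transitivity (\sum_(x : 'I_n * 'I_p) xi x.1 x.2 w ^+ 2); last by apply: eq_bigl => x.
  rewrite -(pair_bigA _ (fun i j => xi i j w ^+ 2)) exchange_big /energy /=.
  by apply: eq_bigr => j _; apply: eq_bigr => i _; rewrite mxE.
under eq_set do rewrite EE.
rewrite (mulrC p%:R) -natrM -cS; exact: (sum_squares_lower_tail indep normalZ S).
Qed.

Lemma measurable_sqn m (h : T -> 'cV[R]_m) :
  (forall i, measurable_fun setT (fun w => h w i 0)) ->
  measurable_fun setT (fun w => sqn (h w)).
Proof. by move=> mh; apply: measurable_sum => i; exact: measurable_funX. Qed.

Lemma measurable_sqn_noise_tr v : measurable_fun setT (fun w => sqn ((noise w)^T *m v)).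
Proof.
apply: measurable_sqn => j; under eq_fun do rewrite mxE.
apply: measurable_sum => i; apply: measurable_funM => //.
under eq_fun do rewrite !mxE.
exact: measurable_funPT.
Qed.

Lemma measurable_sqn_noise z : measurable_fun setT (fun w => sqn (noise w *m z)).
Proof.
apply: measurable_sqn => j; under eq_fun do rewrite mxE.
apply: measurable_sum => i; apply: measurable_funM => //.
under eq_fun do rewrite !mxE.
exact: measurable_funPT.
Qed.

Lemma measurable_sqn_factors : measurable_fun setT (fun w => sqn (factors w)).
Proof.
apply: measurable_sqn => j; under eq_fun do rewrite mxE.
exact: measurable_funPT.
Qed.

Lemma measurable_energy : measurable_fun setT (fun w => energy (noise w)).
Proof.
apply: measurable_sum => j; apply: measurable_sum => i.
apply: measurable_funX; under eq_fun do rewrite mxE.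
exact: measurable_funPT.
Qed.

Let rho : R := 9 / 10 * expR (19 / 162 * (85 / 100)).

Lemma net_exception_le : 150 ^+ 4 * n%:R <= p%:R :> R ->
  #|@grid_ball n|%:R * q ^+ p <= 2^-1 ^+ n.
Proof.
move=> np; have q0 : 0 <= q by exact: upper_rate_ge0.
(* The grid costs [2 ^+ (402 * n)], so the surplus [n] in the exponent is what survives the union
   bound. It suffices that [p >= 41 * 403 * n]. *)
have qp : q ^+ p <= 2^-1 ^+ (403 * n).
  apply: (@le_trans _ _ (q ^+ (41 * (403 * n)))); last first.
    by rewrite exprM lerXn2r ?nnegrE ?exprn_ge0 ?invr_ge0 // upper_rate_exp41.
  rewrite ler_wiXn2l ?(ltW upper_rate_lt1) //.
  rewrite -(ler_nat R) !natrM; apply: le_trans np.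
  have : 0 <= n%:R :> R by []; lra.
apply: le_trans (ler_pM _ _ (card_grid_ball n) qp) _ => //.
  by rewrite exprn_ge0.
have -> : (403 * n = 402 * n + n)%N by rewrite -[in RHS](mul1n n) mulnA -mulnDl.
by rewrite exprD mulrA -exprMn divff // expr1n mul1r.
Qed.

(** The event is described by finitely many grid points and involves only the noise and the factors.
    It is therefore measurable whatever the selection of the maximizer. *)
Lemma good_event (z : 'cV[R]_p) (K := 2 / (19 / 20) ^+ 2 * p%:R : R) :
  (0 < n)%N -> 150 ^+ 4 * n%:R <= p%:R :> R -> sqn z = 1 ->
  exists A : set T, [/\ measurable A,
    ((1 - (2^-1 ^+ n + q ^+ n + q ^+ n + rho ^+ n))%:E <= P A)%E &
    forall w, A w -> [/\ forall v, sqn ((noise w)^T *m v) <= K * sqn v,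
      sqn (factors w) <= 2 * n%:R, sqn (noise w *m z) <= 2 * n%:R &
      85 / 100 * (p%:R * n%:R) <= energy (noise w)]].
Proof.
move=> n0 np z1.
have q0 : 0 <= q by exact: upper_rate_ge0.
pose B1 (g : grid_index n) := [set w | 2 * p%:R < sqn ((noise w)^T *m grid_point g)].
pose B2 := [set w | 2 * n%:R < sqn (noise w *m z)].
pose B3 := [set w | 2 * n%:R < sqn (factors w)].
pose B4 := [set w | energy (noise w) < 85 / 100 * (p%:R * n%:R)].
pose B1U := \big[setU/set0]_(g <- enum (@grid_ball n)) B1 g.
have mB1 g : measurable (B1 g).
  by apply: measurable_lt_set => //; exact: measurable_sqn_noise_tr.
have mB1U : measurable B1U by exact: bigsetU_measurable.
have mB2 : measurable B2 by apply: measurable_lt_set => //; exact: measurable_sqn_noise.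
have mB3 : measurable B3 by apply: measurable_lt_set => //; exact: measurable_sqn_factors.
have mB4 : measurable B4 by apply: measurable_lt_set => //; exact: measurable_energy.
pose B := B1U `|` B2 `|` B3 `|` B4.
have mB : measurable B by do ?apply: measurableU.
exists (~` B); split; first exact: measurableC.
  rewrite probability_setC // EFinB; apply: leeB => //.
  rewrite !EFinD /B.
  apply: le_trans (measureU2 _ _ _) _ => //; first by do ?apply: measurableU.
  apply: leeD; last first.
    have rho0 : 0 <= rho by rewrite mulr_ge0 ?expR_ge0 ?divr_ge0.
    have rho1 : rho <= 1 by exact: ltW lower_rate_lt1.
    apply: le_trans energy_lower_tail _; rewrite lee_fin ler_wiXn2l //.
    rewrite leq_pmulr // -(ltr_nat R); apply: lt_le_trans np.
    by rewrite mulr_gt0 ?exprn_gt0 // ltr0n.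
  apply: le_trans (measureU2 _ _ _) _ => //; first by apply: measurableU.
  apply: leeD; last exact: factors_upper_tail.
  apply: le_trans (measureU2 _ _ _) _ => //.
  apply: leeD; last by apply: noise_upper_tail; rewrite z1.
  apply: (@le_trans _ _ (#|@grid_ball n|%:R * q ^+ p)%:E); last first.
    by rewrite lee_fin net_exception_le.
  rewrite cardE; apply: prob_bigsetU_le => // g; rewrite mem_enum => gB.
  exact: noise_tr_upper_tail (sqn_grid_point gB).
move=> w; rewrite /B !setCU => -[[[nB1 nB2] nB3] nB4]; split.
- have gw g : g \in @grid_ball n -> sqn ((noise w)^T *m grid_point g) <= 2 * p%:R.
    move=> gB; rewrite leNgt; apply/negP => bad; apply: nB1.
    by rewrite /B1U -bigcup_seq; exists g => //=; rewrite mem_enum.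
  move=> v; have := grid_norm_le n0 (_ : 0 <= 2 * p%:R) gw v.
  by rewrite /K [_ / _ * p%:R]mulrAC; apply; rewrite mulr_ge0.
- by rewrite leNgt; apply/negP.
- by rewrite leNgt; apply/negP.
- by rewrite leNgt; apply/negP.
Qed.

End model.

Theorem corollary1p3 (R : realType) (c alpha : R) (p k : nat -> nat)
    (beta : nat -> R) (z : forall n : nat, 'cV[R]_(p n))
    (d : nat -> measure_display) (T : forall n : nat, measurableType (d n))
    (P : forall n : nat, probability (T n) R)
    (u : forall n : nat, 'I_n -> {RV (P n) >-> R})
    (xi : forall n : nat, 'I_n -> 'I_(p n) -> {RV (P n) >-> R})
    (X : forall n : nat, T n -> 'M[R]_(p n))
    (hz : forall n : nat, sparse_spike (k n) (z n))
    (hmodel : forall n : nat, gaussian_model (u n) (xi n))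
    (hc : 1 <= c) (halpha : 1 <= alpha)
    (hp_oo : p n @[n --> \oo] --> \oo)
    (hk_oo : k n @[n --> \oo] --> \oo)
    (hp_n : (p n)%:R / (n%:R `^ alpha) @[n --> \oo] --> c)
    (hbeta_gt0 : forall n : nat, 0 < beta n)
    (hbeta_le : \forall n \near \oo, beta n <= Num.sqrt ((p n)%:R / n%:R))
    (hk_ge : \forall n \near \oo, 2 * (p n)%:R / Num.sqrt n%:R <= (k n)%:R :> R)
    (hk_p : (k n)%:R / (p n)%:R @[n --> \oo] --> (0 : R))
    (hp_ge : \forall n \near \oo, 150 ^+ 4 * n%:R <= (p n)%:R :> R)
    (hX : forall (n : nat) (w : T n),
       sdp_solution (sample_cov (beta n) (z n) (u n) (xi n) w) (k n) (X n w)) :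
  with_prob_tending_to_one P
    (fun n => [set w : T n |
       1 / 3 <= spectral_norm (X n w - z n *m (z n)^T)]).
Proof.
pose good n : Prop := [/\ (0 < n)%N, beta n <= Num.sqrt ((p n)%:R / n%:R),
  2 * (p n)%:R / Num.sqrt n%:R <= (k n)%:R :> R & 150 ^+ 4 * n%:R <= (p n)%:R :> R].
pose q : R := 2 * expR (- (3 / 4)).
pose rho : R := 9 / 10 * expR (19 / 162 * (85 / 100)).
(* An event is required at every index. Where [good] fails the empty set is used, which does not
   affect the limit because [good] holds eventually. *)
have evt n : exists A : set (T n), [/\ measurable A,
    A `<=` [set w : T n | 1 / 3 <= spectral_norm (X n w - z n *m (z n)^T)] &
    good n -> ((1 - (2^-1 ^+ n + q ^+ n + q ^+ n + rho ^+ n))%:E <= P n A)%E].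
  have [[n0 hb hk np]|ng] := pselect (good n); last first.
    by exists set0; split => // /ng.
  have z1 : sqn (z n) = 1 by case: (hz n).
  have [A [mA PA HA]] := good_event (hmodel n) n0 np z1.
  exists A; split => // w /HA[HK hU hN hE] /=.
  have := hX n w; rewrite sample_covE => hXw.
  apply: (sdp_solution_far n0 z1 (ltW (hbeta_gt0 n)) hb np _ hk HK hU hN hE hXw).
  by apply: le_trans np; rewrite ler_peMr ?exprn_ge0 // ler1n.
exists (fun n => proj1_sig (cid (evt n))); split.
- by move=> n; case: cid => A [].
- by move=> n; case: cid => A [].
apply: (@squeeze_cvge _ _ _ _
  (fun n => (1 - (2^-1 ^+ n + q ^+ n + q ^+ n + rho ^+ n))%:E) _ (fun=> 1%E)).
- near=> n; apply/andP; split; last first.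
    by apply: probability_le1; case: cid => A [].
  case: cid => A [_ _ +] /=; apply; split.
  + by near: n; exact: nbhs_infty_gt.
  + by near: n.
  + by near: n.
  + by near: n.
- apply: cvg_EFin; first by near=> n.
  have c0 (r : R) : 0 <= r -> r < 1 -> r ^+ n @[n --> \oo] --> (0 : R).
    by move=> r0 r1; apply: cvg_expr; rewrite ger0_norm.
  have qc := c0 q upper_rate_ge0 upper_rate_lt1.
  have hc2 : (2^-1 : R) ^+ n @[n --> \oo] --> (0 : R).
    by apply: c0; rewrite ?invr_ge0 // invf_lt1 // ltr1n.
  have rc : rho ^+ n @[n --> \oo] --> (0 : R).
    by apply: c0; [rewrite mulr_ge0 ?expR_ge0 ?divr_ge0 | exact: lower_rate_lt1].
  rewrite -[X in _ --> X]subr0 -[X in _ --> _ - X](addr0 0).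
  rewrite -[X in _ --> _ - (X + _)](addr0 0) -[X in _ --> _ - (X + _ + _)](addr0 0).
  apply: cvgB; first exact: cvg_cst.
  by do 3 ?apply: cvgD.
- exact: cvg_cst.
Unshelve. all: by end_near.
Qed.
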